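(* Let $M=\mathbb{R}^2$ or $M=\mathbb{T}^2$, and let $\|\cdot\|_s$ denote the norm of the Sobolev space $H^s(M)$. Let $\Omega$ be a solution of the 2D Euler equation $\partial_t\Omega+\{\Psi,\Omega\}=0$ on $M$, with stream function $\Psi$ satisfying $\Omega=\Delta\Psi$. Let $\lambda$ be an imaginary constant (independent of $t$ and of the space variables), and let $\varphi$ be a complex-valued function with $\varphi(t,\cdot)\in H^s(M)$, $\varphi(t,\cdot)\neq 0$, solving the Lax pair at $(\Omega,\lambda)$: $$\{\Omega,\varphi\}=\lambda\varphi,\qquad \partial_t\varphi+\{\Psi,\varphi\}=0 .$$ Then the quantity $$I=\frac{\|\{\Omega,\varphi\}\|_s}{\|\varphi\|_s}$$ is a conservation law, i.e. $I$ is independent of $t$.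
   Context: The space variables are $(x,y)\in M$ and $t$ is time. The bracket is $\{f,g\}=(\partial_x f)(\partial_y g)-(\partial_y f)(\partial_x g)$. The stream function $\Psi$ gives the velocity $(u,v)$ by $u=-\partial_y\Psi$, $v=\partial_x\Psi$, and the vorticity is $\Omega=\partial_x v-\partial_y u=\Delta\Psi$. The 2D Euler equation in vorticity form is $\partial_t\Omega+\{\Psi,\Omega\}=0$. Solutions are understood to be regular enough that all the equations and norms in the statement make sense. *)

(* Defs.v *)
From mathcomp Require Import all_boot all_order all_algebra.
From mathcomp Require Import all_classical all_reals all_analysis.
From mathcomp Require Import complex.

Set Implicit Arguments.
Unset Strict Implicit.
Unset Printing Implicit Defensive.

Import Order.TTheory GRing.Theory Num.Theory.
Import numFieldNormedType.Exports.

Local Open Scope classical_set_scope.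
Local Open Scope ring_scope.
Local Open Scope complex_scope.

(* [Torus] is (R / 2 pi Z)^2.  Functions on it are encoded as functions on
   R * R that are 2 pi-periodic in each variable; see [on_domain]. *)
Inductive domain := Plane | Torus.

Section fields.
Context {R : realType}.

Definition on_domain (M : domain) (T : Type) (f : R * R -> T) : Prop :=
  match M with
  | Plane => True
  | Torus => forall x y : R,
      f (x + 2 * pi, y) = f (x, y) /\ f (x, y + 2 * pi) = f (x, y)
  end.

Definition dx (f : R * R -> R) : R * R -> R :=
  fun p => 'D_((1, 0) : R * R) f p.
Definition dy (f : R * R -> R) : R * R -> R :=
  fun p => 'D_((0, 1) : R * R) f p.

Definition laplacian (f : R * R -> R) : R * R -> R :=
  fun p => dx (dx f) p + dy (dy f) p.

Definition bracket (f g : R * R -> R) : R * R -> R :=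
  fun p => dx f p * dy g p - dy f p * dx g p.

Definition reF (T : Type) (f : T -> R[i]) : T -> R := fun p => complex.Re (f p).
Definition imF (T : Type) (f : T -> R[i]) : T -> R := fun p => complex.Im (f p).

(* {f, g} for a real f and a complex-valued g; derivatives of complex-valued
   functions of real variables are taken componentwise. *)
Definition cbracket (f : R * R -> R) (g : R * R -> R[i]) : R * R -> R[i] :=
  fun p => bracket f (reF g) p +i* bracket f (imF g) p.

Definition cderive1 (g : R -> R[i]) : R -> R[i] :=
  fun t => derive1 (reF g) t +i* derive1 (imF g) t.

End fields.

Section sobolev.
Context {R : realType}.

Definition leb2 : set (measurableTypeR R * measurableTypeR R) -> \bar R :=
  (@lebesgue_measure R \x @lebesgue_measure R)%E.

Definition cintegrable (D : set (R * R)) (f : R * R -> R[i]) : Prop :=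
  leb2.-integrable D (EFin \o reF f) /\ leb2.-integrable D (EFin \o imF f).

Definition cintegral (D : set (R * R)) (f : R * R -> R[i]) : R[i] :=
  Rintegral leb2 D (reF f) +i* Rintegral leb2 D (imF f).

Definition cis (a : R) : R[i] := cos a +i* sin a.

Definition dot2 (p q : R * R) : R := p.1 * q.1 + p.2 * q.2.

Definition sqnormc (z : R[i]) : R := complex.Re z ^+ 2 + complex.Im z ^+ 2.

(* The Sobolev weight (1 + |xi|^2)^s. *)
Definition weight (s : R) (xi : R * R) : R := (1 + dot2 xi xi) `^ s.

(* Real-valued C_c^oo(R^2): every iterated partial derivative exists and is
   differentiable. *)
Definition test_function (eta : R * R -> R) : Prop :=
  (forall vs : seq bool, forall p : R * R,
     differentiable (foldr (fun b h => if b then dx h else dy h) eta vs) p) /\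
  (exists r : R, forall p : R * R, r < `|p| -> eta p = 0).

(* Inverse Fourier transform with the unitary normalization in dimension 2. *)
Definition inv_fourier (eta : R * R -> R) (xi : R * R) : R[i] :=
  ((2 * pi)^-1)%:C * cintegral setT (fun x => (eta x)%:C * cis (dot2 x xi)).

(* g is the Fourier transform of the locally integrable function f, in the
   sense of distributions: f and the inverse transform of g agree against
   every test function. *)
Definition is_fourier (f g : R * R -> R[i]) : Prop :=
  [/\ measurable_fun setT (reF g : measurableTypeR R * measurableTypeR R -> R),
      measurable_fun setT (imF g : measurableTypeR R * measurableTypeR R -> R) &
      forall eta : R * R -> R, test_function eta ->
        [/\ cintegrable setT (fun x => f x * (eta x)%:C),
            cintegrable setT (fun xi => g xi * inv_fourier eta xi) &
            cintegral setT (fun x => f x * (eta x)%:C) =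
            cintegral setT (fun xi => g xi * inv_fourier eta xi)]].

(* The transform g is unique up to a null set, so that the infimum is the
   norm of that g; it is +oo when f does not belong to H^s. *)
Definition sobolev_norm_plane (s : R) (f : R * R -> R[i]) : \bar R :=
  ereal_inf [set ((\int[leb2]_xi (weight s xi * sqnormc (g xi))%:E) `^ 2^-1)%E
            | g in is_fourier f].

Definition torus_cell : set (R * R) := `[0, 2 * pi] `*` `[0, 2 * pi].

Definition frequency (k : int * int) : R * R := (k.1%:~R, k.2%:~R).

(* Normalized so that s = 0 gives the L^2 norm over one period cell. *)
Definition fourier_coef (f : R * R -> R[i]) (k : int * int) : R[i] :=
  ((2 * pi)^-1)%:C *
  cintegral torus_cell (fun x => f x * cis (- dot2 x (frequency k))).

Definition sobolev_norm_torus (s : R) (f : R * R -> R[i]) : \bar R :=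
  ((\esum_(k in [set: int * int])
     (weight s (frequency k) * sqnormc (fourier_coef f k))%:E) `^ 2^-1)%E.

Definition sobolev_norm (M : domain) : R -> (R * R -> R[i]) -> \bar R :=
  match M with
  | Plane => sobolev_norm_plane
  | Torus => sobolev_norm_torus
  end.

Definition in_sobolev (M : domain) (s : R) (f : R * R -> R[i]) : Prop :=
  match M with
  | Plane => True
  | Torus => on_domain Torus f /\ cintegrable torus_cell f
  end /\ (sobolev_norm M s f < +oo)%E.

End sobolev.

Section euler.
Context {R : realType}.

(* Classical solutions for times in J; the first argument of Psi, Omega and
   phi is time. *)
Definition euler_solution (M : domain) (J : set R)
    (Psi Omega : R -> R * R -> R) : Prop :=
  forall t : R, J t ->
    [/\ on_domain M (Psi t) /\ on_domain M (Omega t),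
        forall p, [/\ differentiable (Psi t) p,
                      differentiable (dx (Psi t)) p &
                      differentiable (dy (Psi t)) p],
        forall p, differentiable (Omega t) p /\
                  derivable (fun tau => Omega tau p) t 1,
        forall p, Omega t p = laplacian (Psi t) p &
        forall p, derive1 (fun tau => Omega tau p) t
                  + bracket (Psi t) (Omega t) p = 0].

Definition lax_solution (M : domain) (J : set R)
    (Psi Omega : R -> R * R -> R) (lambda : R[i])
    (phi : R -> R * R -> R[i]) : Prop :=
  forall t : R, J t ->
    [/\ on_domain M (phi t),
        forall p, differentiable (reF (phi t)) p /\
                  differentiable (imF (phi t)) p,
        forall p, derivable (reF (fun tau => phi tau p)) t 1 /\
                  derivable (imF (fun tau => phi tau p)) t 1,
        forall p, cbracket (Omega t) (phi t) p = lambda * phi t p &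
        forall p, cderive1 (fun tau => phi tau p) t
                  + cbracket (Psi t) (phi t) p = 0].

Definition lax_quotient (M : domain) (s : R) (Omega : R -> R * R -> R)
    (phi : R -> R * R -> R[i]) (t : R) : R :=
  fine (sobolev_norm M s (cbracket (Omega t) (phi t)))
  / fine (sobolev_norm M s (phi t)).

End euler.

(* Main.v *)
Require Import Defs.
From mathcomp Require Import all_boot all_order all_algebra.
From mathcomp Require Import all_classical all_reals all_analysis.
From mathcomp Require Import complex.
From mathcomp Require Import measurable_realfun ring lra.

(** The first equation of the Lax pair says that [phi t] is an eigenfunction of
    the operator [cbracket (Omega t)] with the constant eigenvalue [lambda], so the
    numerator of the quotient is the norm of [lambda * phi t]. The Sobolev norm is
    absolutely homogeneous ([sobolev_normZ]), hence the quotient equals the modulus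
    of [lambda] at every time, provided that the norm of [phi t] is neither
    infinite nor zero. It is finite because [phi t] lies in H^s. The substance of
    the proof is that a continuous function whose Sobolev norm, of any real order,
    is zero vanishes at every point ([sobolev_norm_eq0]). By homogeneity it is
    enough to show that the real part is nowhere positive.

    On the torus, zero norm means that all Fourier coefficients are zero, so the
    real part of [f] is orthogonal to every trigonometric polynomial. The powers of
    [bump_kernel q] are trigonometric polynomials which concentrate at [q], and a
    positive value of the real part at [q] would make the integral against a high
    power positive ([reF_le0_of_fourier_coef_eq0]).

    On the plane, zero norm means that [f] has distributional Fourier transforms of
    arbitrarily small weighted L^2 norm. Paired with a test function, [f] gives the
    pairing of such a transform with the inverse transform of the test function,
    which decays faster than any power; hence the pairing is as small as desired,
    and so zero ([Rintegral_test_eq0]). Products of one-dimensional smooth bumps are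
    enough as test functions. Their inverse transforms are oscillatory integrals
    whose decay follows from repeated integration by parts in one variable and
    Fubini ([osc_decay], [osc2_decay]), and a bump placed where the real part of [f]
    is positive gives a contradiction ([reF_le0_plane]). *)

Import Order.TTheory GRing.Theory Num.Theory.
Import numFieldNormedType.Exports.

Local Open Scope classical_set_scope.
Local Open Scope ring_scope.
Local Open Scope complex_scope.

Set Implicit Arguments.
Unset Strict Implicit.

(** * Homogeneity of the Sobolev norms *)

Section scaling.
Context {R : realType}.
Implicit Types (c : R[i]) (f g h : R * R -> R[i]) (D : set (R * R)).

Notation P2 := (measurableTypeR R * measurableTypeR R)%type.

Definition absc c : R := Num.sqrt (sqnormc c).

Lemma sqnormc_ge0 c : 0 <= sqnormc c.
Proof. by rewrite addr_ge0 ?sqr_ge0. Qed.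

Lemma sqnormcM c d : sqnormc (c * d) = sqnormc c * sqnormc d.
Proof. by case: c d => a b [x y]; rewrite /sqnormc /=; ring. Qed.

Lemma sqnormc_eq0 c : (sqnormc c == 0) = (c == 0).
Proof.
by case: c => a b; rewrite /sqnormc /= paddr_eq0 ?sqr_ge0 // !sqrf_eq0 eq_complex.
Qed.

Lemma absc_eq0 c : (absc c == 0) = (c == 0).
Proof. by rewrite /absc sqrtr_eq0 -sqnormc_eq0 eq_le sqnormc_ge0 andbT. Qed.

Lemma absc0 : absc 0 = 0.
Proof. by apply/eqP; rewrite absc_eq0. Qed.

Lemma abscM c d : absc (c * d) = absc c * absc d.
Proof. by rewrite /absc sqnormcM sqrtrM ?sqnormc_ge0. Qed.

Lemma absc1 : absc 1 = 1.
Proof. by rewrite /absc /sqnormc /= expr0n expr1n addr0 sqrtr1. Qed.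

Lemma poweR_sqnormc c : ((sqnormc c)%:E `^ 2^-1)%E = (absc c)%:E.
Proof. by rewrite poweR_EFin powR12_sqrt ?sqnormc_ge0. Qed.

Lemma reF_mulE c f : reF (fun p => c * f p) =
  (fun p => complex.Re c * reF f p - complex.Im c * imF f p).
Proof. by apply/funext => p; rewrite /reF /imF; case: c (f p) => a b [x y]. Qed.

Lemma imF_mulE c f : imF (fun p => c * f p) =
  (fun p => complex.Re c * imF f p + complex.Im c * reF f p).
Proof. by apply/funext => p; rewrite /reF /imF; case: c (f p) => a b [x y]. Qed.

Lemma integrable_scale D (k : R) (u : R * R -> R) : measurable (D : set P2) ->
  leb2.-integrable D (EFin \o u) ->
  leb2.-integrable D (EFin \o (fun x => k * u x)).
Proof. by move=> mD /(integrableZl mD k); apply: eq_integrable. Qed.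

Lemma cintegrableZ D c f : measurable (D : set P2) ->
  cintegrable D f -> cintegrable D (fun p => c * f p).
Proof.
move=> mD [fr fi]; split; rewrite ?reF_mulE ?imF_mulE.
  have := integrableB mD (integrableZl mD (complex.Re c) fr)
                         (integrableZl mD (complex.Im c) fi).
  by apply: eq_integrable.
have := integrableD mD (integrableZl mD (complex.Re c) fi)
                       (integrableZl mD (complex.Im c) fr).
by apply: eq_integrable.
Qed.

Lemma cintegralZ D c f : measurable (D : set P2) -> cintegrable D f ->
  cintegral D (fun p => c * f p) = c * cintegral D f.
Proof.
move=> mD [fr fi]; rewrite /cintegral reF_mulE imF_mulE.
rewrite RintegralB ?RintegralD ?RintegralZl //; try exact: integrable_scale.
by case: c => a b.
Qed.

(** The duality that defines the transform is linear on both sides, so a multiple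
    of a transform is a transform of the multiple. *)
Lemma is_fourierZ c f g : is_fourier f g ->
  is_fourier (fun p => c * f p) (fun p => c * g p).
Proof.
move=> [mr mi fg]; split.
- rewrite reF_mulE; apply: measurable_funB; exact: measurable_funM.
- rewrite imF_mulE; apply: measurable_funD; exact: measurable_funM.
move=> eta /fg [If Ig E].
have -> : (fun x => c * f x * (eta x)%:C) = (fun x => c * (f x * (eta x)%:C)).
  by apply/funext => x; rewrite mulrA.
have -> : (fun x => c * g x * inv_fourier eta x) = (fun x => c * (g x * inv_fourier eta x)).
  by apply/funext => x; rewrite mulrA.
by split; rewrite ?cintegralZ ?E//; exact: cintegrableZ.
Qed.

Lemma measurable_dot2 : measurable_fun setT (fun p : P2 => dot2 p p : R).
Proof. by apply: measurable_funD; apply: measurable_funM. Qed.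

Lemma weight_base_gt0 (xi : R * R) : 0 < 1 + dot2 xi xi.
Proof. by rewrite ltr_pwDl// addr_ge0// -expr2 sqr_ge0. Qed.

Lemma measurable_weight s : measurable_fun setT (weight s : P2 -> R).
Proof.
apply: (measurableT_comp (measurable_powR s)).
by apply: measurable_funD => //; exact: measurable_dot2.
Qed.

Lemma measurable_sqnormc g : measurable_fun setT (reF g : P2 -> R) ->
  measurable_fun setT (imF g : P2 -> R) ->
  measurable_fun setT ((fun xi => sqnormc (g xi)) : P2 -> R).
Proof. by move=> mr mi; apply: measurable_funD; exact: measurable_funX. Qed.

Lemma sobolev_norm_ge0 M s f : (0 <= sobolev_norm M s f)%E.
Proof.
case: M => /=; last exact: poweR_ge0.
by apply: le_ereal_inf_tmp => _ [g _ <-]; exact: poweR_ge0.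
Qed.

Lemma weight_gt0 s (xi : R * R) : 0 < weight s xi.
Proof. by rewrite powR_gt0// weight_base_gt0. Qed.

Lemma weight_ge0 s (xi : R * R) : 0 <= weight s xi.
Proof. exact: powR_ge0. Qed.

(** Scaling the transforms of [f] gives some of the transforms of [c f], hence an
    inequality between the infima. The reverse inequality comes from scaling back
    by [c^-1] in [sobolev_normZ]. For [c = 0] the finiteness hypothesis supplies a
    transform of [f]; without one the right-hand side would be [0 * +oo = 0]. *)
Lemma sobolev_norm_planeZ_le s c f : (sobolev_norm_plane s f < +oo)%E ->
  (sobolev_norm_plane s (fun p => c * f p)%R
   <= (absc c)%:E * sobolev_norm_plane s f)%E.
Proof.
move=> fin.
have le g : is_fourier f g -> (sobolev_norm_plane s (fun p => c * f p)%R
   <= (absc c)%:E * (\int[leb2]_xi (weight s xi * sqnormc (g xi))%:E) `^ 2^-1)%E.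
  move=> fg; apply: ereal_inf_lbound; exists (fun p => c * g p).
    exact: is_fourierZ.
  case: fg => mr mi _.
  rewrite -poweR_sqnormc -poweRM ?lee_fin ?sqnormc_ge0//; last first.
    by apply: integral_ge0 => x _; rewrite lee_fin mulr_ge0 ?weight_ge0 ?sqnormc_ge0.
  congr (_ `^ _)%E; rewrite -ge0_integralZl_EFin ?sqnormc_ge0//.
  - by apply: eq_integral => x _; rewrite sqnormcM -EFinM mulrCA.
  - by move=> x _; rewrite lee_fin mulr_ge0 ?weight_ge0 ?sqnormc_ge0.
  - apply/measurable_EFinP; apply: measurable_funM; first exact: measurable_weight.
    exact: measurable_sqnormc.
have [/eqP|c0] := eqVneq (absc c) 0.
  rewrite absc_eq0 => /eqP c0.
  have [_ [g fg <-] _] := ereal_inf_lt fin.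
  by have := le g fg; rewrite c0 absc0 !mul0e.
have cp : 0 < absc c by rewrite lt_def c0 sqrtr_ge0.
rewrite -lee_pdivrMl//; apply: le_ereal_inf_tmp => _ [g fg <-].
by rewrite lee_pdivrMl//; exact: le.
Qed.

Lemma measurable_torus_cell : measurable (torus_cell : set P2).
Proof. by apply: measurableX; exact: measurable_itv. Qed.

Lemma measurable_cosine (k : R * R) (a : R) :
  measurable_fun setT (fun x : P2 => cos (dot2 x k + a)).
Proof.
have mcos : measurable_fun setT (cos : R -> R).
  by apply: continuous_measurable_fun; exact: continuous_cos.
apply: (measurableT_comp mcos).
by apply: measurable_funD => //; apply: measurable_funD; apply: measurable_funM.
Qed.

Lemma measurable_sine (k : R * R) (a : R) :
  measurable_fun setT (fun x : P2 => sin (dot2 x k + a)).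
Proof.
under eq_fun do rewrite -cosBpihalf -addrA.
exact: measurable_cosine.
Qed.

Lemma integrableM_le1 D (u v : R * R -> R) : measurable (D : set P2) ->
  leb2.-integrable D (EFin \o u) -> measurable_fun setT (v : P2 -> R) ->
  (forall x, `|v x| <= 1) -> leb2.-integrable D (EFin \o (fun x => u x * v x)).
Proof.
move=> mD iu mv v1; apply: (le_integrable mD _ _ iu).
  apply/measurable_EFinP; apply: measurable_funM.
    by apply/measurable_EFinP; exact: measurable_int iu.
  exact: measurable_funTS.
by move=> x _; rewrite lee_fin /= normrM ler_piMr.
Qed.

Lemma cintegrableM_cis D f (k : R * R) : measurable (D : set P2) ->
  cintegrable D f -> cintegrable D (fun x => f x * cis (- dot2 x k)).
Proof.
move=> mD [fr fi].
have mc : measurable_fun setT (fun x : P2 => cos (- dot2 x k)).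
  by under eq_fun do rewrite cosN -[dot2 _ _]addr0; exact: measurable_cosine.
have ms : measurable_fun setT (fun x : P2 => sin (- dot2 x k)).
  under eq_fun do rewrite sinN -[dot2 _ _]addr0.
  apply: measurableT_comp => //; exact: measurable_sine.
have c1 x : `|cos (- dot2 x k)| <= 1 by exact: cos_max.
have s1 x : `|sin (- dot2 x k)| <= 1 by exact: sin_max.
split.
  have := integrableB mD (integrableM_le1 mD fr mc c1) (integrableM_le1 mD fi ms s1).
  apply: eq_integrable => // x _; rewrite /= -EFinB; congr EFin.
  by rewrite /reF /imF; case: (f x).
have := integrableD mD (integrableM_le1 mD fr ms s1) (integrableM_le1 mD fi mc c1).
apply: eq_integrable => // x _; rewrite /= -EFinD; congr EFin.
by rewrite /reF /imF; case: (f x).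
Qed.

Lemma fourier_coefZ c f k : cintegrable torus_cell f ->
  fourier_coef (fun p => c * f p) k = c * fourier_coef f k.
Proof.
move=> intf; rewrite /fourier_coef mulrCA; congr (_ * _).
rewrite -cintegralZ; first by congr cintegral; apply/funext => x; rewrite mulrA.
  exact: measurable_torus_cell.
by apply: cintegrableM_cis => //; exact: measurable_torus_cell.
Qed.

Lemma sobolev_norm_torusZ_le s c f : cintegrable torus_cell f ->
  (sobolev_norm_torus s (fun p => c * f p)%R
   <= (absc c)%:E * sobolev_norm_torus s f)%E.
Proof.
move=> intf.
have w0 k : (0 <= (weight s (frequency k) * sqnormc (fourier_coef f k))%:E)%E.
  by rewrite lee_fin mulr_ge0 ?weight_ge0 ?sqnormc_ge0.
rewrite /sobolev_norm_torus -poweR_sqnormc -poweRM ?lee_fin ?sqnormc_ge0//; last first.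
  by apply esum_ge0 => k _; exact: w0.
apply: gt0_ler_poweR => //; rewrite ?in_itv /= ?leey ?andbT.
- by apply esum_ge0 => k _; rewrite lee_fin mulr_ge0 ?weight_ge0 ?sqnormc_ge0.
- by rewrite mule_ge0 ?lee_fin ?sqnormc_ge0//; apply esum_ge0 => k _; exact: w0.
apply: ge_ereal_sup => _ [X [finX _] <-].
under eq_fsbigr do rewrite fourier_coefZ// sqnormcM mulrCA EFinM.
rewrite -ge0_mule_fsumr//; apply: lee_wpmul2l; rewrite ?lee_fin ?sqnormc_ge0//.
by apply: ereal_sup_ubound; exists X.
Qed.

(** Membership is carried along with the inequality so that the lemma can be
    applied a second time, to [c f] and [c^-1]. *)
Lemma in_sobolevZ_le M s c f : in_sobolev M s f ->
  in_sobolev M s (fun p => c * f p) /\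
  (sobolev_norm M s (fun p => c * f p)%R <= (absc c)%:E * sobolev_norm M s f)%E.
Proof.
move=> [dom fin].
have le : (sobolev_norm M s (fun p => c * f p)%R
           <= (absc c)%:E * sobolev_norm M s f)%E.
  case: M dom fin => [_ fin|[_ intf] _]; first exact: sobolev_norm_planeZ_le.
  exact: sobolev_norm_torusZ_le.
split=> //; split; last first.
  apply: (le_lt_trans le); rewrite lte_mul_pinfty ?lee_fin ?sqrtr_ge0//.
case: M dom {fin le} => //= -[per intf]; split.
  by move=> x y; have [-> ->] := per x y.
by apply: cintegrableZ => //; exact: measurable_torus_cell.
Qed.

Lemma sobolev_normZ M s c f : in_sobolev M s f ->
  sobolev_norm M s (fun p => c * f p) = ((absc c)%:E * sobolev_norm M s f)%E.
Proof.
move=> Hf; have [Hcf le] := in_sobolevZ_le c Hf.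
apply/eqP; rewrite eq_le le /=.
have [->|c0] := eqVneq c 0; first by rewrite absc0 mul0e sobolev_norm_ge0.
have [_] := in_sobolevZ_le c^-1 Hcf.
under eq_fun do rewrite mulKf//.
have cp : 0 < absc c by rewrite lt_def absc_eq0 c0 sqrtr_ge0.
have -> : absc c^-1 = (absc c)^-1.
  by apply: (mulIf (lt0r_neq0 cp)); rewrite -abscM mulVf// absc1 mulVf ?lt0r_neq0.
by rewrite lee_pdivlMl.
Qed.

End scaling.

(** * Integrals bounded below on a box *)

Section box.
Context {R : realType}.
Notation P2 := (measurableTypeR R * measurableTypeR R)%type.

Definition box (q : R * R) (d : R) : set (R * R) :=
  [set p | `|p.1 - q.1| <= d /\ `|p.2 - q.2| <= d].

Lemma boxE q d : box q d = `[q.1 - d, q.1 + d] `*` `[q.2 - d, q.2 + d].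
Proof.
apply/seteqP; split=> -[x y]; rewrite /box /= !in_itv /= !ler_distl => -[? ?].
  by split.
by split.
Qed.

Lemma measurable_box q d : measurable (box q d : set P2).
Proof. by rewrite boxE; apply: measurableX; exact: measurable_itv. Qed.

Lemma leb2_box q d : 0 < d -> leb2 (box q d) = ((2 * d) ^+ 2)%:E.
Proof.
move=> d0; have E (x : R) : lebesgue_measure `[x - d, x + d] = (2 * d)%:E.
  rewrite lebesgue_measure_itv /= lte_fin.
  have -> : x - d < x + d by rewrite ltrD2l; lra.
  by rewrite -EFinB; congr EFin; ring.
rewrite boxE /leb2.
transitivity (lebesgue_measure `[(q.1 - d)%R, (q.1 + d)%R] *
              lebesgue_measure `[(q.2 - d)%R, (q.2 + d)%R])%E.
  by rewrite product_measure1E//; exact: measurable_itv.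
by rewrite !E -EFinM expr2.
Qed.

(** The contradiction on the torus and on the plane is the same: an integral that is
    too small for a function which is nonnegative everywhere and at least [m] on a
    box. *)
Lemma Rintegral_ge_box (D : set (R * R)) (h : R * R -> R) (m : R) q d :
  measurable (D : set P2) -> leb2.-integrable D (EFin \o h) ->
  (forall x, D x -> 0 <= h x) -> 0 < d -> box q d `<=` D ->
  (forall x, box q d x -> m <= h x) -> 0 <= m ->
  m * (2 * d) ^+ 2 <= Rintegral leb2 D h.
Proof.
move=> mD ih h0 d0 sub mh m0.
have mB := measurable_box q d.
have mf : measurable_fun (D : set P2) (EFin \o h) by exact: measurable_int ih.
rewrite -lee_fin fineK; last exact: integrable_fin_num ih.
apply: (@le_trans _ _ (\int[leb2]_(x in box q d) (h x)%:E)%E); last first.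
  by apply: ge0_subset_integral => // x Dx; rewrite lee_fin; exact: h0.
rewrite EFinM -(leb2_box q d0) -integral_cst//.
apply: ge0_le_integral => //; first exact: measurable_funS mf.
Qed.

End box.

(** * Uniqueness of Fourier coefficients on the torus *)

Section torus.
Context {R : realType}.
Notation P2 := (measurableTypeR R * measurableTypeR R)%type.
Implicit Types (f : R * R -> R[i]) (u g : R * R -> R) (k m : int * int).

Lemma dot2_frequencyD (x : R * R) k m :
  dot2 x (frequency (k + m)) = dot2 x (frequency k) + dot2 x (frequency m).
Proof. by rewrite /dot2 /= !intrD; ring. Qed.

Lemma dot2_frequencyN (x : R * R) k :
  dot2 x (frequency (- k)) = - dot2 x (frequency k).
Proof. by rewrite /dot2 /= !intrN; ring. Qed.

(** For complex [f] a single coefficient mixes the real and imaginary parts of [f];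
    the coefficients at [k] and [- k] together separate them. The phase [a] lets
    one cosine stand for both the cosine and the sine. *)
Lemma Rintegral_cosine_eq0 f : cintegrable torus_cell f ->
  (forall k, fourier_coef f k = 0) ->
  forall k a, Rintegral leb2 torus_cell
    (fun x => reF f x * cos (dot2 x (frequency k) + a)) = 0.
Proof.
move=> intf coef0 k a; have [fr fi] := intf.
have mD := @measurable_torus_cell R.
have mc l : measurable_fun setT (fun x : P2 => cos (dot2 x (frequency l))).
  by under eq_fun do rewrite -[dot2 _ _]addr0; exact: measurable_cosine.
have ms l : measurable_fun setT (fun x : P2 => sin (dot2 x (frequency l))).
  by under eq_fun do rewrite -[dot2 _ _]addr0; exact: measurable_sine.
have Iuc l := integrableM_le1 mD fr (mc l) (fun=> cos_max _).
have Ius l := integrableM_le1 mD fr (ms l) (fun=> sin_max _).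
have Ivc l := integrableM_le1 mD fi (mc l) (fun=> cos_max _).
have Ivs l := integrableM_le1 mD fi (ms l) (fun=> sin_max _).
pose Uc l := Rintegral leb2 torus_cell (fun x => reF f x * cos (dot2 x (frequency l))).
pose Us l := Rintegral leb2 torus_cell (fun x => reF f x * sin (dot2 x (frequency l))).
pose Vc l := Rintegral leb2 torus_cell (fun x => imF f x * cos (dot2 x (frequency l))).
pose Vs l := Rintegral leb2 torus_cell (fun x => imF f x * sin (dot2 x (frequency l))).
have eqs l : Uc l + Vs l = 0 /\ Vc l - Us l = 0.
  have /eqP := coef0 l; rewrite /fourier_coef mulf_eq0 => /orP[/eqP[]|/eqP[] E1 E2].
    by move/eqP; rewrite invr_eq0 mulf_eq0 pnatr_eq0 /= gt_eqF// pi_gt0.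
  split.
    rewrite -[RHS]E1 -RintegralD//; apply: eq_Rintegral => x _.
    by rewrite /reF /imF /cis sinN cosN; case: (f x) => ? ? /=; ring.
  rewrite -[RHS]E2 -RintegralB//; apply: eq_Rintegral => x _.
  by rewrite /reF /imF /cis sinN cosN; case: (f x) => ? ? /=; ring.
have opp l : Uc (- l) = Uc l /\ Vc (- l) = Vc l.
  by split; apply: eq_Rintegral => x _; rewrite dot2_frequencyN cosN.
have opps l : Us (- l) = - Us l /\ Vs (- l) = - Vs l.
  split; rewrite -[RHS]mulN1r -RintegralZl//; apply: eq_Rintegral => x _;
  by rewrite dot2_frequencyN sinN; ring.
have [U0 S0] : Uc k = 0 /\ Us k = 0.
  have [e1 e2] := eqs k; have [] := eqs (- k).
  have [-> ->] := opp k; have [-> ->] := opps k => e3 e4.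
  by split; lra.
transitivity (cos a * Uc k - sin a * Us k); last by rewrite U0 S0; ring.
rewrite -!RintegralZl// -RintegralB//; try exact: integrable_scale.
by apply: eq_Rintegral => x _; rewrite cosD; ring.
Qed.

(** Orthogonality of [u * g] to every trigonometric monomial, bundled with what
    keeps the products integrable, so that it is preserved when [g] is multiplied
    by a further trigonometric factor. *)
Definition cosine_orthogonal u g :=
  [/\ measurable_fun setT (g : P2 -> R), forall x, `|g x| <= 1 &
   forall k a, Rintegral leb2 torus_cell
    (fun x => u x * g x * cos (dot2 x (frequency k) + a)) = 0].

(** The product of two cosines is half the sum of the cosines of the sum and of the
    difference of their arguments, which are again of the form allowed. *)
Lemma cosine_orthogonalM u g m b :
  leb2.-integrable torus_cell (EFin \o u) -> cosine_orthogonal u g ->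
  cosine_orthogonal u (fun x => g x * ((1 + cos (dot2 x (frequency m) + b)) / 2)).
Proof.
move=> iu [mg g1 g0]; split.
- apply: measurable_funM => //; apply: measurable_funM => //.
  by apply: measurable_funD => //; exact: measurable_cosine.
- move=> x; rewrite normrM mulr_ile1//.
  have := cos_geN1 (dot2 x (frequency m) + b).
  have := cos_le1 (dot2 x (frequency m) + b).
  by rewrite ler_norml; lra.
move=> k a.
have mD := @measurable_torus_cell R.
have I l c : leb2.-integrable torus_cell
    (EFin \o (fun x => u x * g x * cos (dot2 x (frequency l) + c))).
  apply: integrableM_le1 => //; last by move=> x; exact: cos_max.
    exact: integrableM_le1.
  exact: measurable_cosine.
pose F l c := Rintegral leb2 torus_cell
    (fun x => u x * g x * cos (dot2 x (frequency l) + c)).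
transitivity (2^-1 * F k a + (4^-1 * F (k + m) (a + b) + 4^-1 * F (k - m) (a - b))).
  have ID : leb2.-integrable torus_cell (EFin \o (fun x =>
    4^-1 * (u x * g x * cos (dot2 x (frequency (k + m)) + (a + b)))
    + 4^-1 * (u x * g x * cos (dot2 x (frequency (k - m)) + (a - b))))).
    have := integrableD mD (integrable_scale 4^-1 mD (I (k + m) (a + b)))
                           (integrable_scale 4^-1 mD (I (k - m) (a - b))).
    by apply: eq_integrable.
  rewrite -!RintegralZl// -!RintegralD//; try exact: integrable_scale.
  apply: eq_Rintegral => x _; rewrite !dot2_frequencyD dot2_frequencyN.
  set A := dot2 x (frequency k); set B := dot2 x (frequency m).
  have -> : A + B + (a + b) = (A + a) + (B + b) by ring.
  have -> : A - B + (a - b) = (A + a) - (B + b) by ring.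
  by rewrite (cosD (A + a)) (cosB (A + a)); field.
by rewrite /F !g0; ring.
Qed.

Lemma cosine_orthogonalMX u m b n g :
  leb2.-integrable torus_cell (EFin \o u) -> cosine_orthogonal u g ->
  cosine_orthogonal u
    (fun x => g x * ((1 + cos (dot2 x (frequency m) + b)) / 2) ^+ n).
Proof.
move=> iu; elim: n g => [|n IH] g Hg.
  by under eq_fun do rewrite expr0 mulr1.
under eq_fun do rewrite exprS mulrA.
by apply: IH; exact: cosine_orthogonalM.
Qed.

(** A trigonometric polynomial with values in [0, 1] that attains 1 only at [q]
    modulo periods; its powers concentrate at [q]. *)
Definition bump_kernel (q x : R * R) : R :=
  ((1 + cos (x.1 - q.1)) / 2) * ((1 + cos (x.2 - q.2)) / 2).

Lemma Rintegral_bump_kernel_eq0 f q n : cintegrable torus_cell f ->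
  (forall k, fourier_coef f k = 0) ->
  measurable_fun setT ((fun x => bump_kernel q x ^+ n) : P2 -> R) /\
  Rintegral leb2 torus_cell (fun x => reF f x * bump_kernel q x ^+ n) = 0.
Proof.
move=> intf coef0; have [fr _] := intf.
have H0 : cosine_orthogonal (reF f) (fun=> 1).
  split=> //; first by move=> x; rewrite normr1.
  move=> k a; under eq_fun do rewrite mulr1; exact: Rintegral_cosine_eq0.
have := cosine_orthogonalMX (0, 1) (- q.2) n fr
         (cosine_orthogonalMX (1, 0) (- q.1) n fr H0).
have -> : (fun x => 1 * ((1 + cos (dot2 x (frequency (1, 0)) - q.1)) / 2) ^+ n *
    ((1 + cos (dot2 x (frequency (0, 1)) - q.2)) / 2) ^+ n) =
    (fun x => bump_kernel q x ^+ n).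
  apply/funext => x; rewrite mul1r -exprMn /bump_kernel /dot2 /=.
  have [-> ->] : (1%:~R = 1 :> R) /\ (0%:~R = 0 :> R) by [].
  by rewrite !mulr0 !mulr1 addr0 add0r.
move=> [mK _ /(_ (0, 0) 0) E]; split=> //; rewrite -[RHS]E.
apply: eq_Rintegral => x _; rewrite /dot2 /= (_ : 0%:~R = 0 :> R)//.
by rewrite !mulr0 !addr0 cos0 mulr1.
Qed.

Lemma ler_cos_itv (x y : R) : 0 <= x -> x <= y -> y <= pi -> cos y <= cos x.
Proof.
move=> x0 xy ypi.
have xI : x \in `[0, pi] by rewrite in_itv /= x0 (le_trans xy).
have yI : y \in `[0, pi] by rewrite in_itv /= ypi (le_trans x0).
by rewrite leNgt ltr_cos// -leNgt.
Qed.

Lemma ler_cos_dist (x d : R) : `|x| <= d -> d <= pi -> cos d <= cos x.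
Proof. by move=> xd dpi; rewrite -(cos_norm x) ler_cos_itv. Qed.

Lemma ger_cos_dist (x d : R) : 0 <= d -> d <= `|x| -> `|x| <= 2 * pi - d ->
  cos x <= cos d.
Proof.
move=> d0 dx xd; rewrite -(cos_norm x); have [xpi|xpi] := leP `|x| pi.
  exact: ler_cos_itv.
have <- : cos (2 * pi - `|x|) = cos `|x|.
  by rewrite -cosN opprB -(cosD2pi (`|x| - 2 * pi)) -[pi *+ 2]mulr_natl subrK.
by apply: ler_cos_itv; lra.
Qed.

Lemma continuous_box_gt u q (m : R) : {for q, continuous u} -> m < u q ->
  exists2 e : R, 0 < e & forall x, box q e x -> m < u x.
Proof.
move=> cu mu; have : \forall x \near q, m < u x by exact: (cvgr_gt _ cu).
move=> /nbhs_ballP[e /= e0 He]; exists (e / 2); first by rewrite divr_gt0.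
move=> [x y] [/= h1 h2]; apply: He; split => /=; rewrite /ball /= distrC.
  by apply: le_lt_trans h1 _; rewrite ltr_pdivrMr// ltr_pMr// ltr1n.
by apply: le_lt_trans h2 _; rewrite ltr_pdivrMr// ltr_pMr// ltr1n.
Qed.

Lemma le0_of_geometric_bound (a b t : R) : 0 <= t -> t < 1 ->
  (forall n, a <= b * t ^+ n) -> a <= 0.
Proof.
move=> t0 t1 H.
have cv : b * t ^+ n @[n --> \oo] --> (0 : R).
  by apply: (cvg_geometric b); rewrite ger0_norm.
rewrite -(cvg_lim _ cv)//; apply: limr_ge; first by apply/cvg_ex; exists 0.
exact: nearW.
Qed.

Lemma bump_kernel_ge0 q x : 0 <= bump_kernel q x.
Proof.
have := cos_geN1 (x.1 - q.1); have := cos_geN1 (x.2 - q.2).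
by move=> h1 h2; rewrite mulr_ge0 ?divr_ge0 //; lra.
Qed.

Lemma bump_kernel_ge q x (d : R) : d <= pi -> box q d x ->
  ((1 + cos d) / 2) ^+ 2 <= bump_kernel q x.
Proof.
move=> dpi [h1 h2]; have := cos_geN1 d.
have := ler_cos_dist h1 dpi; have := ler_cos_dist h2 dpi => c2 c1 c0.
by rewrite expr2; apply: ler_pM; lra.
Qed.

Lemma bump_kernel_le q x (d : R) : 0 <= d ->
  `|x.1 - q.1| <= 2 * pi - d -> `|x.2 - q.2| <= 2 * pi - d -> ~ box q d x ->
  bump_kernel q x <= (1 + cos d) / 2.
Proof.
move=> d0 b1 b2 nb.
have := cos_geN1 (x.1 - q.1); have := cos_geN1 (x.2 - q.2).
have := cos_le1 (x.1 - q.1); have := cos_le1 (x.2 - q.2) => l2 l1 g2 g1.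
have [h1|h1] := leP `|x.1 - q.1| d.
  have [h2|h2] := leP `|x.2 - q.2| d; first by case: nb.
  have := ger_cos_dist d0 (ltW h2) b2 => c2.
  by rewrite -[leRHS]mul1r; apply: ler_pM; lra.
have := ger_cos_dist d0 (ltW h1) b1 => c1.
by rewrite -[leRHS]mulr1; apply: ler_pM; lra.
Qed.

(** If [reF f q] were positive, [reF f] would exceed a constant [m] on the box of
    radius [d] at [q]. With [c = cos (d / 2)] the kernel is at most [c ^+ 2] off
    this box and at least [((1 + c) / 2) ^+ 2] on the box of radius [d / 2]. As
    [c < (1 + c) / 2], for large powers of the kernel the positive contribution
    near [q] beats everything else, while the whole integral vanishes. The point
    [q] is interior so that the cell contains no second maximum of the kernel. *)
Lemma reF_le0_of_fourier_coef_eq0 f q : cintegrable torus_cell f ->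
  (forall k, fourier_coef f k = 0) -> {for q, continuous (reF f)} ->
  0 < q.1 < 2 * pi -> 0 < q.2 < 2 * pi -> reF f q <= 0.
Proof.
move=> intf coef0 cf /andP[q1 q1'] /andP[q2 q2']; rewrite leNgt; apply/negP => fq.
have pi0 := @pi_gt0 R.
have mD := @measurable_torus_cell R.
have [fr _] := intf.
pose m := reF f q / 2.
have m0 : 0 < m by rewrite divr_gt0.
have [|e e0 He] := @continuous_box_gt (reF f) q m cf.
  by rewrite /m ltr_pdivrMr// ltr_pMr// ltr1n.
(* The bound [pi] makes [cos (d / 2)] nonnegative; the last four keep the box inside
   the cell and every point of the cell within [2 * pi - d] of [q]. *)
pose d := Num.min e (Num.min pi (Num.min (Num.min q.1 (2 * pi - q.1))
                                         (Num.min q.2 (2 * pi - q.2)))).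
have d0 : 0 < d by rewrite !lt_min e0 pi0 q1 q2 !subr_gt0 q1' q2'.
have [de dpi dq] : [/\ d <= e, d <= pi &
    [/\ d <= q.1, d <= 2 * pi - q.1, d <= q.2 & d <= 2 * pi - q.2]].
  by have := lexx d; rewrite {2}/d !le_min => /and3P[? ? /andP[/andP[? ?] /andP[? ?]]].
case: dq => dq1 dq1' dq2 dq2'.
pose c := cos (d / 2).
have c0 : 0 <= c.
  by apply: cos_ge0_pihalf; lra.
have c1 : c < 1.
  by rewrite -cos0 ltr_cos ?in_itv/=; lra.
have cd : (1 + cos d) / 2 = c ^+ 2.
  have -> : d = (d / 2) *+ 2 by rewrite -mulr_natr divfK.
  by rewrite cos_mulr2n -/c; field.
pose rho := (1 + c) / 2.
have rho0 : 0 < rho by rewrite /rho; lra.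
have crho : c < rho by rewrite /rho; lra.
pose L := Rintegral leb2 torus_cell (fun x => `|reF f x|).
suff : m * (2 * (d / 2)) ^+ 2 <= 0.
  by rewrite leNgt mulr_gt0// exprn_gt0// mulrC divfK.
apply: (@le0_of_geometric_bound _ L ((c / rho) ^+ 2)); first exact: sqr_ge0.
  by rewrite expr_lt1// ?ltr_pdivrMr ?mul1r// divr_ge0// ltW.
move=> n.
have [mK K0] := Rintegral_bump_kernel_eq0 q n intf coef0.
rewrite (expr_div_n c) (expr_div_n (c ^+ 2)) [leRHS]mulrA ler_pdivlMr ?exprn_gt0//.
have Iabs : leb2.-integrable torus_cell (EFin \o (fun x => `|reF f x|)).
  by have := integrable_abse fr; apply: eq_integrable.
have IK : leb2.-integrable torus_cell
    (EFin \o (fun x => reF f x * bump_kernel q x ^+ n)).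
  apply: integrableM_le1 => // x; rewrite normrX exprn_ile1// ger0_norm ?bump_kernel_ge0//.
  have := cos_geN1 (x.1 - q.1); have := cos_geN1 (x.2 - q.2).
  have := cos_le1 (x.1 - q.1); have := cos_le1 (x.2 - q.2) => *.
  by apply: mulr_ile1; lra.
have IL : leb2.-integrable torus_cell
    (EFin \o (fun x => (c ^+ 2) ^+ n * `|reF f x|)).
  by have := integrableZl mD ((c ^+ 2) ^+ n) Iabs; apply: eq_integrable.
(* Off the box the integrand may be negative, but is at least - c^(2n) |Re f|. *)
have -> : L * (c ^+ 2) ^+ n = Rintegral leb2 torus_cell
    (fun x => reF f x * bump_kernel q x ^+ n + (c ^+ 2) ^+ n * `|reF f x|).
  by rewrite RintegralD// K0 add0r RintegralZl// mulrC.
have -> : m * (2 * (d / 2)) ^+ 2 * (rho ^+ 2) ^+ n =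
          (m * (rho ^+ 2) ^+ n) * (2 * (d / 2)) ^+ 2 by ring.
have inbox x : box q (d / 2) x -> box q d x.
  by case=> ? ?; split; lra.
have box_pos x : box q d x -> m < reF f x.
  by case=> ? ?; apply: He; split; lra.
apply: (@Rintegral_ge_box _ _ _ _ q) => //.
- by have := integrableD mD IK IL; apply: eq_integrable.
- move=> x [/=]; rewrite !in_itv /= => /andP[x1 x1'] /andP[x2 x2'].
  have [bx|nbx] := pselect (box q d x).
    rewrite addr_ge0 ?mulr_ge0 ?exprn_ge0 ?bump_kernel_ge0//.
    by rewrite (le_trans (ltW m0))// ltW// box_pos.
  have Kle : bump_kernel q x ^+ n <= (c ^+ 2) ^+ n.
    apply: lerXn2r; rewrite ?nnegrE ?bump_kernel_ge0 ?sqr_ge0// -cd.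
    by apply: bump_kernel_le => //; rewrite ?ler_norml; lra.
  have K0' : 0 <= bump_kernel q x ^+ n by rewrite exprn_ge0 ?bump_kernel_ge0.
  have := ler_norm (- reF f x); rewrite normrN => un.
  have := ler_wpM2r (normr_ge0 (reF f x)) Kle.
  have := ler_wpM2r K0' un; lra.
- by rewrite divr_gt0.
- move=> [x y] [/=]; rewrite !ler_distl => /andP[? ?] /andP[? ?].
  by split; rewrite /= in_itv /=; apply/andP; split; lra.
- move=> x bx; rewrite -[leLHS]addr0 lerD ?mulr_ge0 ?exprn_ge0//.
  apply: ler_pM; [exact: ltW|by rewrite exprn_ge0 ?sqr_ge0| |].
    exact/ltW/box_pos/inbox.
  apply: lerXn2r; rewrite ?nnegrE ?bump_kernel_ge0 ?sqr_ge0//.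
  by apply: bump_kernel_ge => //; lra.
- by rewrite mulr_ge0 ?exprn_ge0 ?sqr_ge0 // ltW.
Qed.

Lemma floor_period (x : R) : exists2 n : int,
  0 <= x - n%:~R * (2 * pi) & x - n%:~R * (2 * pi) < 2 * pi.
Proof.
have pi0 : 0 < 2 * pi :> R by rewrite mulr_gt0// pi_gt0.
exists (Num.floor (x / (2 * pi))).
  by rewrite subr_ge0 -ler_pdivlMr// floor_le_tmp.
have := floorD1_gt (x / (2 * pi)).
by rewrite intrD ltr_pdivrMr// mulrDl mul1r -ltrBlDl.
Qed.

Lemma periodicz (T : Type) (f : R -> T) (a : R) :
  (forall x, f (x + a) = f x) -> forall (n : int) x, f (x + n%:~R * a) = f x.
Proof.
move=> per; have pn n x : f (x + n%:R * a) = f x.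
  elim: n => [|n IH]; first by rewrite mul0r addr0.
  by rewrite -natr1 mulrDl mul1r addrA per.
case=> n x; first exact: pn.
by rewrite NegzE -[LHS](pn n.+1) mulrNz mulNr addrNK.
Qed.

Lemma on_torusz f p k : on_domain Torus f ->
  f (p.1 + k.1%:~R * (2 * pi), p.2 + k.2%:~R * (2 * pi)) = f p.
Proof.
move=> per; case: p k => [x y] [k1 k2] /=.
rewrite (@periodicz _ (fun y => f (x + k1%:~R * (2 * pi), y))); last first.
  by move=> y'; have [_ ->] := per (x + k1%:~R * (2 * pi)) y'.
rewrite (@periodicz _ (fun x => f (x, y)))// => x'.
by have [-> _] := per x' y.
Qed.

Lemma fourier_coef_eq0 s f : sobolev_norm_torus s f = 0%E ->
  forall k, fourier_coef f k = 0.
Proof.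
pose F k := (weight s (frequency k) * sqnormc (fourier_coef f k))%:E.
have F0 k : (0 <= F k)%E.
  by rewrite lee_fin mulr_ge0 ?weight_ge0 ?sqnormc_ge0.
move=> /poweR_eq0_eq0; rewrite esum_ge0//; last by move=> k _; exact: F0.
move=> /(_ isT) S0 k.
have /eqP : F k = 0%E.
  apply/eqP; rewrite eq_le F0 andbT -S0.
  by apply: esum_ge; exists [set k]; rewrite ?fsbig_set1//; split.
rewrite /F eqe mulf_eq0 gt_eqF ?weight_gt0//=.
by rewrite sqnormc_eq0 => /eqP.
Qed.

(** Every point is a period translate of a point of the half-open cell, and near any
    such point a positive value would persist at an interior point. *)
Lemma reF_le0_torus s f p : in_sobolev Torus s f -> sobolev_norm_torus s f = 0%E ->
  continuous (reF f) -> reF f p <= 0.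
Proof.
move=> [[per intf] _] /fourier_coef_eq0 coef0 cf.
wlog [/andP[x0 x1] /andP[y0 y1]] : p / 0 <= p.1 < 2 * pi /\ 0 <= p.2 < 2 * pi.
  move=> H; have [k1 a1 b1] := floor_period p.1; have [k2 a2 b2] := floor_period p.2.
  rewrite /reF -(on_torusz p (- k1, - k2) per) /= !mulrNz !mulNr.
  by apply: H; rewrite /= a1 b1 a2 b2.
rewrite leNgt; apply/negP => fp.
have [e e0 He] := continuous_box_gt (cf p) fp.
pose d := Num.min e (Num.min ((2 * pi - p.1) / 2) ((2 * pi - p.2) / 2)).
have d0 : 0 < d by rewrite !lt_min e0 !divr_gt0// subr_gt0.
have [de d1 d2] : [/\ d <= e, d <= (2 * pi - p.1) / 2 & d <= (2 * pi - p.2) / 2].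
  by have := lexx d; rewrite {2}/d !le_min => /and3P[].
suff : reF f (p.1 + d, p.2 + d) <= 0.
  by rewrite leNgt He// /box /= ![_ + d]addrC !addrK gtr0_norm.
apply: reF_le0_of_fourier_coef_eq0 => //; [exact: cf|rewrite /=; lra|rewrite /=; lra].
Qed.

End torus.

(** * Smooth functions of one variable and bumps *)

Section smooth.
Context {R : realType}.
Implicit Types (f g : R -> R) (P : {poly R}).

(** Smoothness through iterated [derive1], in a recursive form that makes closure
    under products a plain induction. *)
Fixpoint nsmooth (n : nat) f : Prop :=
  if n is n'.+1 then (forall x, derivable f x 1) /\ nsmooth n' (derive1 f) else True.

Definition smooth f := forall n, nsmooth n f.

Lemma smooth_derivable f : smooth f -> forall x, derivable f x 1.
Proof. by move=> sf x; have [] := sf 1. Qed.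

Lemma smooth_derive1 f : smooth f -> smooth (derive1 f).
Proof. by move=> sf n; have [] := sf n.+1. Qed.

Lemma smooth_continuous f : smooth f -> continuous f.
Proof.
by move=> sf x; apply: differentiable_continuous; apply/derivable1_diffP/smooth_derivable.
Qed.

Lemma nsmoothS n f : nsmooth n.+1 f -> nsmooth n f.
Proof. by elim: n f => // n IH f [df /IH]. Qed.

Lemma nsmoothD n f g : nsmooth n f -> nsmooth n g ->
  nsmooth n (fun x => f x + g x).
Proof.
elim: n f g => // n IH f g [df sf] [dg sg]; split.
  by move=> x; apply: derivableD.
have -> : derive1 (fun x => f x + g x) = (fun x => derive1 f x + derive1 g x).
  by apply/funext => x; rewrite !derive1E deriveD.
exact: IH.
Qed.

Lemma nsmoothM n f g : nsmooth n f -> nsmooth n g ->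
  nsmooth n (fun x => f x * g x).
Proof.
elim: n f g => // n IH f g sf sg.
have [df df'] := sf; have [dg dg'] := sg; split.
  by move=> x; apply: derivableM.
have -> : derive1 (fun x => f x * g x) = (fun x => f x * derive1 g x + g x * derive1 f x).
  by apply/funext => x; rewrite !derive1E deriveM.
by apply: nsmoothD; apply: IH => //; exact: nsmoothS.
Qed.

Lemma is_derive_affine f (k c x : R) : (forall y, derivable f y 1) ->
  is_derive x 1 (fun x => f (k * x + c)) (k * derive1 f (k * x + c)).
Proof.
move=> df.
have Da : is_derive x 1 (fun x : R => k * x + c) k.
  by apply: is_derive_eq; rewrite addr0 /GRing.scale /= mulr1.
have := @is_derive1_comp R f (fun x => k * x + c) x _ _
  (derivableP (df (k * x + c))) Da.
by rewrite derive1E mulrC.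
Qed.

Lemma nsmooth_affine n f (r k c : R) : nsmooth n f ->
  nsmooth n (fun x => r * f (k * x + c)).
Proof.
elim: n f r => // n IH f r [df sf].
have D (x : R) : is_derive x 1 (fun x => r * f (k * x + c)) (r * (k * derive1 f (k * x + c))).
  have := is_derive_affine k c x df => H.
  exact: is_deriveZ.
split; first by move=> x; have [] := D x.
have -> : derive1 (fun x => r * f (k * x + c)) =
          (fun x => (r * k) * derive1 f (k * x + c)).
  by apply/funext => x; rewrite derive1E; have [_ ->] := D x; rewrite mulrA.
exact: IH.
Qed.

Lemma smoothM f g : smooth f -> smooth g -> smooth (fun x => f x * g x).
Proof. by move=> sf sg n; exact: nsmoothM. Qed.

Lemma smooth_affine f (k c : R) : smooth f -> smooth (fun x => f (k * x + c)).
Proof.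
move=> sf n; have := nsmooth_affine 1 k c (sf n).
by under eq_fun do rewrite mul1r.
Qed.

(** An exponential beats every power; the extra factor [u ^+ k] makes the induction
    on the polynomial go through. *)
Lemma poly_expR_bounded P k : exists2 C : R, 0 <= C &
  forall u, 0 < u -> `|P.[u]| * u ^+ k * expR (- u) <= C.
Proof.
have X j u : 0 < u -> u ^+ j * expR (- u) <= (j`!%:R : R).
  move=> u0; rewrite expRN ler_pdivrMr ?expR_gt0//.
  case: j => [|j]; first by rewrite expr0 fact0 mul1r -expR0 ler_expR ltW.
  rewrite mulrC -ler_pdivrMr ?ltr0n ?fact_gt0//.
  by apply: le_trans (expR_ge1Dxn j (ltW u0)); rewrite lerDr.
elim/poly_ind: P k => [|P c IH] k.
  by exists 0 => // u _; rewrite horner0 normr0 !mul0r.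
have [C C0 HC] := IH k.+1; exists (C + `|c| * k`!%:R).
  by rewrite addr_ge0 ?mulr_ge0.
move=> u u0; rewrite hornerMXaddC.
have E0 : 0 <= u ^+ k * expR (- u) by rewrite mulr_ge0 ?exprn_ge0 ?expR_ge0 ?ltW.
rewrite -mulrA; apply: (@le_trans _ _ ((`|P.[u]| * u + `|c|) * (u ^+ k * expR (- u)))).
  by rewrite ler_wpM2r// (le_trans (ler_normD _ _))// normrM (gtr0_norm u0).
rewrite mulrDl lerD ?ler_wpM2l ?X//.
by apply: le_trans (HC u u0); rewrite exprS !mulrA.
Qed.

Lemma is_derive_quadratic_bound f a (C : R) :
  (forall x, `|f x - f a| <= C * (x - a) ^+ 2) -> is_derive a (1 : R) f 0.
Proof.
move=> H.
have cv : (fun h => h^-1 *: ((f \o shift a) (h *: 1) - f a)) @ 0^' --> (0 : R).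
  apply/cvgr0Pnorm_le => e e0.
  have cvC : (fun h : R => C * h) @ 0^' --> (0 : R).
    rewrite -[X in _ --> X](mulr0 C); apply: cvgM; first exact: cvg_cst.
    exact: nbhs_dnbhs.
  move/cvgr0Pnorm_le : cvC => /(_ e e0); apply: filterS2 (nbhs_dnbhs_neq (0 : R)).
  move=> h h0 he; rewrite /= scaler1 normrM normfV ler_pdivrMl ?normr_gt0//.
  apply: le_trans (H _) _; rewrite addrK.
  apply: le_trans (ler_norm _) _.
  by rewrite expr2 mulrA normrM mulrC ler_wpM2l.
split; first by apply/cvg_ex; exists 0.
exact: cvg_lim cv.
Qed.

(** The functions [P(1/x) exp(-1/x)], flat at the origin, form a class closed under
    differentiation; [flat_exp 1] is the classical flat function. *)
Definition flat_exp P (x : R) : R :=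
  if 0 < x then P.[x^-1] * expR (- x^-1) else 0.

(** Away from the origin this is the chain rule. At the origin
    [`|flat_exp P x| <= C * x ^+ 2], because [u ^+ 2 * P(u) * exp(- u)] is bounded
    for [u = x^-1 > 0]. *)
Lemma is_derive_flat_exp P (x : R) :
  is_derive x 1 (flat_exp P) (flat_exp ('X^2 * (P - P^`())) x).
Proof.
have [x0|x0|->] := ltgtP x 0.
- have -> : flat_exp ('X^2 * (P - P^`())) x = 0 by rewrite /flat_exp ltNge (ltW x0).
  have nx : \forall y \near x, cst 0 y = flat_exp P y.
    by apply: filterS (lt_nbhsl x0) => y y0; rewrite /flat_exp ltNge (ltW y0).
  exact: (near_eq_is_derive nx).
- have nx : \forall y \near x, (fun y => P.[y^-1] * expR (- y^-1)) y = flat_exp P y.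
    by apply: filterS (lt_nbhsr x0) => y y0; rewrite /flat_exp y0.
  apply: (near_eq_is_derive nx).
  have Di : is_derive x 1 (fun y : R => y^-1) (- x ^- 2).
    have := @is_deriveV R id x 1 1 (lt0r_neq0 x0) (is_derive_id _ _).
    by rewrite /GRing.scale /= mulr1.
  have DP : is_derive x 1 (fun y : R => P.[y^-1]) (P^`().[x^-1] * (- x ^- 2)).
    have DH : is_derive (x^-1) 1 (horner P) (P^`().[x^-1]).
      split; first exact: derivable_horner.
      by rewrite -derive1E derivE.
    exact: (@is_derive1_comp R (horner P) _ x _ _ DH Di).
  have DE : is_derive x 1 (fun y : R => expR (- y^-1)) (expR (- x^-1) * (x ^- 2)).
    have DN : is_derive x 1 (fun y : R => - y^-1) (x ^- 2).
      by have := is_deriveN Di; rewrite opprK.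
    exact: (@is_derive1_comp R expR _ x _ _ (is_derive_expR _) DN).
  split; first by have [] := is_deriveM DP DE.
  have [_ ->] := is_deriveM DP DE.
  rewrite /flat_exp x0 /GRing.scale /= hornerM hornerXn hornerD hornerN -exprVn; ring.
have -> : flat_exp ('X^2 * (P - P^`())) 0 = 0 by rewrite /flat_exp ltxx.
have [C C0 HC] := poly_expR_bounded P 2.
apply: (@is_derive_quadratic_bound _ _ C) => y.
rewrite {2}/flat_exp ltxx !subr0 /flat_exp; case: ifPn => y0; last first.
  by rewrite normr0 mulr_ge0 ?sqr_ge0.
rewrite normrM (gtr0_norm (expR_gt0 _)) -ler_pdivrMr ?exprn_gt0// -exprVn mulrAC.
by apply: HC; rewrite invr_gt0.
Qed.

Lemma smooth_flat_exp P : smooth (flat_exp P).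
Proof.
move=> n; elim: n P => // n IH P; split.
  by move=> x; have [] := is_derive_flat_exp P x.
have -> : derive1 (flat_exp P) = flat_exp ('X^2 * (P - P^`())).
  by apply/funext => x; rewrite derive1E; have [_ ->] := is_derive_flat_exp P x.
exact: IH.
Qed.

Definition bump1 (a b x : R) : R := flat_exp 1 (x - a) * flat_exp 1 (b - x).

Lemma flat_exp1_ge0 x : 0 <= flat_exp 1 x.
Proof. by rewrite /flat_exp; case: ifP => // _; rewrite hornerC mul1r expR_ge0. Qed.

Lemma smooth_bump1 a b : smooth (bump1 a b).
Proof.
have := smoothM (smooth_affine 1 (- a) (smooth_flat_exp 1))
                (smooth_affine (- 1) b (smooth_flat_exp 1)).
congr smooth; apply/funext => x; rewrite /bump1 mul1r mulN1r; congr (_ * flat_exp _ _).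
exact: addrC.
Qed.

Lemma bump1_ge0 a b x : 0 <= bump1 a b x.
Proof. by rewrite mulr_ge0 ?flat_exp1_ge0. Qed.

Lemma bump1_gt0 a b x : a < x -> x < b -> 0 < bump1 a b x.
Proof.
move=> ax xb; rewrite /bump1 /flat_exp !subr_gt0 ax xb !hornerC !mul1r.
by rewrite mulr_gt0 ?expR_gt0.
Qed.

Lemma bump1_eq0 a b x : x < a \/ b < x -> bump1 a b x = 0.
Proof.
rewrite /bump1 /flat_exp !subr_gt0 => -[/ltW|/ltW]; rewrite leNgt => /negbTE ->.
  by rewrite mul0r.
by rewrite mulr0.
Qed.

End smooth.

(** * Tensor products as test functions *)

Section test_functions.
Context {R : realType}.
Implicit Types (b c : R -> R).

Definition tensor b c (p : R * R) : R := b p.1 * c p.2.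

Lemma dx_tensor b c : smooth b -> dx (tensor b c) = tensor (derive1 b) c.
Proof.
move=> sb; apply/funext => p; rewrite /dx /derive /tensor derive1E.
rewrite [RHS]mulrC -deriveMr; last exact: smooth_derivable.
rewrite /derive; apply: (congr1 (fun F : R -> R => lim (F @ 0^'))); apply/funext => h /=.
by rewrite /GRing.scale /= mulr0 add0r.
Qed.

Lemma dy_tensor b c : smooth c -> dy (tensor b c) = tensor b (derive1 c).
Proof.
move=> sb; apply/funext => p; rewrite /dy /derive /tensor derive1E.
rewrite -deriveMl; last exact: smooth_derivable.
rewrite /derive; apply: (congr1 (fun F : R -> R => lim (F @ 0^'))); apply/funext => h /=.
by rewrite /GRing.scale /= mulr0 add0r.
Qed.

Lemma differentiable_tensor b c p : smooth b -> smooth c ->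
  differentiable (tensor b c) p.
Proof.
move=> sb sc.
have d1 : differentiable (fst : R * R -> R) p.
  by apply: linear_differentiable => x; exact: cvg_fst.
have d2 : differentiable (snd : R * R -> R) p.
  by apply: linear_differentiable => x; exact: cvg_snd.
apply: (@differentiableM _ _ (b \o fst) (c \o snd)).
  by apply: differentiable_comp => //; apply/derivable1_diffP/smooth_derivable.
by apply: differentiable_comp => //; apply/derivable1_diffP/smooth_derivable.
Qed.

(** Partial derivatives of a tensor product are tensor products of derivatives, so
    all the iterated ones are differentiable. *)
Lemma test_function_tensor b c (r : R) : smooth b -> smooth c ->
  (forall x, r < `|x| -> b x = 0) -> (forall x, r < `|x| -> c x = 0) ->
  test_function (tensor b c).
Proof.
move=> sb sc b0 c0; split; last first.
  exists r => -[x y]; rewrite /tensor /Num.norm /= lt_max => /orP[/b0 ->|/c0 ->].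
    by rewrite mul0r.
  by rewrite mulr0.
move=> vs p.
have [b' [c' [sb' sc' ->]]] : exists b' c', [/\ smooth b', smooth c' &
    foldr (fun d h => if d then dx h else dy h) (tensor b c) vs = tensor b' c'].
  elim: vs => [|d vs [b' [c' [sb' sc' /= ->]]]]; first by exists b, c.
  case: d; last first.
    by exists b', (derive1 c'); split => //; [exact: smooth_derive1|exact: dy_tensor].
  by exists (derive1 b'), c'; split => //; [exact: smooth_derive1|exact: dx_tensor].
exact: differentiable_tensor.
Qed.

End test_functions.

(** * Decay of one-dimensional oscillatory integrals *)

Section oscillatory.
Context {R : realType}.
Implicit Types (b c : R -> R).
Notation mu := (@lebesgue_measure R).

Definition supported (l h : R) c := forall x, x < l \/ h < x -> c x = 0.

Lemma supported_derive1 l h c : supported l h c -> supported l h (derive1 c).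
Proof.
move=> c0 x xlh; rewrite derive1E (near_eq_derive (g := cst 0)) ?derive_cst//.
case: xlh => xlh.
  by apply: filterS (lt_nbhsl xlh) => y yl; apply: c0; left.
by apply: filterS (lt_nbhsr xlh) => y yl; apply: c0; right.
Qed.

(** The interval is enlarged by 1 on both sides so that [c] vanishes at its
    endpoints without appeal to continuity: no boundary terms appear when
    integrating by parts. *)
Lemma supported_restrict l h c (g : R -> R) :
  supported l h c -> (fun x => c x * g x) = (fun x => c x * g x) \_ `[l - 1, h + 1].
Proof.
move=> c0; apply/funext => x; rewrite patchE; case: ifPn => //.
rewrite notin_setE /= in_itv /= => /negP; rewrite negb_and -!ltNge => /orP[xl|xh].
  by rewrite c0 ?mul0r//; left; lra.
by rewrite c0 ?mul0r//; right; lra.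
Qed.

Lemma continuous_cosine (xi th : R) : continuous (fun x : R => cos (x * xi + th)).
Proof.
move=> x; apply: continuous_comp; last exact: continuous_cos.
apply: cvgD; last exact: cvg_cst.
by apply: cvgM; [exact: cvg_id|exact: cvg_cst].
Qed.

Lemma integrable_supported l h c (g : R -> R) : supported l h c ->
  continuous c -> continuous g ->
  mu.-integrable setT (EFin \o (fun x => c x * g x)).
Proof.
move=> c0 cc cg.
rewrite (supported_restrict g c0).
have := @integrable_mkcond _ _ R mu `[l - 1, h + 1] (EFin \o (fun x => c x * g x)).
rewrite restrict_EFin => -[//|+ _]; apply.
apply: continuous_compact_integrable; first exact: segment_compact.
by apply: continuous_subspaceT => x; apply: cvgM; [exact: cc|exact: cg].
Qed.

Lemma integrable_smooth_supported l h c : smooth c -> supported l h c ->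
  mu.-integrable setT (EFin \o c).
Proof.
move=> sc c0; have c1 : continuous (fun _ : R => 1 : R) by move=> x; exact: cvg_cst.
have := integrable_supported c0 (smooth_continuous sc) c1.
by under [X in EFin \o X]eq_fun do rewrite mulr1.
Qed.

(** The phase [th] is kept arbitrary: it makes sines cosines, and lets one variable
    of a double integral be treated as a parameter. *)
Definition osc c (xi th : R) : R :=
  Rintegral mu setT (fun x => c x * cos (x * xi + th)).

(** Integration by parts, the sine being a cosine with shifted phase; thus a power of
    the frequency is traded for a derivative of [c]. *)
Lemma osc_derive1 l h c xi th : l <= h -> smooth c -> supported l h c ->
  xi * osc c xi th = - osc (derive1 c) xi (th - pi / 2).
Proof.
move=> lh sc c0.
have sc' := smooth_derive1 sc.
pose G (x : R) := sin (x * xi + th).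
have DG (x : R) : is_derive x 1 G (xi * cos (x * xi + th)).
  have Da : is_derive x 1 (fun x : R => x * xi + th) xi.
    have := is_deriveD (is_deriveM (is_derive_id x (1 : R)) (is_derive_cst xi x 1))
                       (is_derive_cst th x 1).
    by rewrite /GRing.scale /= mulr0 add0r mulr1 addr0.
  have := @is_derive1_comp R sin (fun x : R => x * xi + th) x _ _ (is_derive_sin _) Da.
  by rewrite mulrC.
have cG : continuous G.
  move=> x; apply: differentiable_continuous; apply/derivable1_diffP.
  by have [] := DG x.
have LR f : (forall x, derivable f x (1 : R)) -> continuous f ->
    derivable_oo_LRcontinuous f (l - 1) (h + 1).
  move=> df cf; split; first by move=> x _; exact: df.
    by apply: cvg_at_right_filter; exact: cf.
  by apply: cvg_at_left_filter; exact: cf.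
have := @Rintegration_by_parts R c G (derive1 c) (fun x => xi * cos (x * xi + th))
  (l - 1) (h + 1).
have -> : c (h + 1) = 0 by apply: c0; right; lra.
have -> : c (l - 1) = 0 by apply: c0; left; lra.
rewrite !mul0r subrr sub0r => H.
rewrite /osc -RintegralZl//; last first.
  by apply: (integrable_supported c0); [exact: smooth_continuous|exact: continuous_cosine].
have -> : (fun x => xi * (c x * cos (x * xi + th))) =
          (fun x => c x * (xi * cos (x * xi + th))).
  by apply/funext => x; rewrite mulrCA.
rewrite (supported_restrict _ c0) -Rintegral_mkcond H; first last.
- by move=> x _; rewrite derive1E; have [] := DG x.
- by apply: LR => // x; have [] := DG x.
- apply: continuous_subspaceT => x; apply: cvgM; first exact: cvg_cst.
  exact: continuous_cosine.
- by [].
- by apply: LR; [exact: smooth_derivable|exact: smooth_continuous].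
- by apply: continuous_subspaceT; exact: smooth_continuous.
- lra.
rewrite Rintegral_mkcond -(supported_restrict G (supported_derive1 c0)).
congr (- _); apply: eq_Rintegral => x _; rewrite /G.
by rewrite -cosBpihalf addrA.
Qed.

(** The constant is the integral of the absolute value of the [n]-th derivative; it
    depends neither on [xi] nor on [th]. *)
Lemma osc_decay l h n c : l <= h -> smooth c -> supported l h c ->
  exists2 C, 0 <= C & forall xi th, `|xi| ^+ n * `|osc c xi th| <= C.
Proof.
move=> lh; elim: n c => [|n IH] c sc c0; last first.
  have [C C0 HC] := IH _ (smooth_derive1 sc) (supported_derive1 c0).
  exists C => // xi th; rewrite exprSr -mulrA -normrM (osc_derive1 _ _ lh sc c0).
  by rewrite normrN.
exists (Rintegral mu setT (fun x => `|c x|)).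
  by apply: Rintegral_ge0.
move=> xi th; rewrite expr0 mul1r.
have I1 : mu.-integrable setT (EFin \o (fun x => c x * cos (x * xi + th))).
  by apply: (integrable_supported c0); [exact: smooth_continuous|exact: continuous_cosine].
have I2 : mu.-integrable setT (EFin \o c).
  exact: integrable_smooth_supported c0.
apply: le_trans (le_normr_Rintegral _ I1) _ => //.
apply: le_Rintegral => //.
- by have := integrable_abse I1; apply: eq_integrable.
- by have := integrable_abse I2; apply: eq_integrable.
by move=> x _; rewrite normrM ler_piMr// cos_max.
Qed.

End oscillatory.

(** * Decay of two-dimensional oscillatory integrals *)

Section decay.
Context {R : realType}.
Implicit Types (b c : R -> R).
Notation mu := (@lebesgue_measure R).
Notation P2 := (measurableTypeR R * measurableTypeR R)%type.

Lemma integrable_tensor b c : mu.-integrable setT (EFin \o b) ->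
  mu.-integrable setT (EFin \o c) -> leb2.-integrable setT (EFin \o tensor b c).
Proof.
move=> ib ic.
have mb : measurable_fun setT b by apply/measurable_EFinP; exact: measurable_int ib.
have mc : measurable_fun setT c by apply/measurable_EFinP; exact: measurable_int ic.
have mt : measurable_fun setT (EFin \o tensor b c : P2 -> _).
  apply/measurable_EFinP; apply: measurable_funM.
    by apply: (measurableT_comp mb); exact: measurable_fst.
  by apply: (measurableT_comp mc); exact: measurable_snd.
apply/(integrable12ltyP mu mu mt).
have E x : (\int[mu]_y `|(EFin \o tensor b c) (x, y)| =
    `|b x|%:E * \int[mu]_y `|(c y)%:E|)%E.
  rewrite -ge0_integralZl_EFin//.
    by apply: eq_integral => y _; rewrite /= normrM EFinM.
  by apply: measurableT_comp => //; exact/measurable_EFinP.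
under eq_integral do rewrite E.
have [mb' fb] := integrableP _ _ _ ib; have [mc' fc] := integrableP _ _ _ ic.
have c0 : (0 <= \int[mu]_y `|(c y)%:E|)%E by exact: integral_ge0.
have b0 : (0 <= \int[mu]_y `|(b y)%:E|)%E by exact: integral_ge0.
have -> : (\int[mu]_y `|(c y)%:E|)%E = (fine (\int[mu]_y `|(c y)%:E|))%:E.
  by rewrite fineK// ge0_fin_numE.
rewrite ge0_integralZr ?lee_fin ?fine_ge0//.
  by rewrite lte_mul_pinfty// ?ge0_fin_numE// ltry.
exact: (measurable_int _ (integrable_abse ib)).
Qed.

Definition osc2 b c (xi : R * R) (th : R) : R :=
  Rintegral leb2 setT (fun p => tensor b c p * cos (dot2 p xi + th)).

Lemma integrable_osc2 b c xi th : mu.-integrable setT (EFin \o b) ->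
  mu.-integrable setT (EFin \o c) -> leb2.-integrable setT
    (EFin \o (fun p => tensor b c p * cos (dot2 p xi + th))).
Proof.
move=> ib ic; apply: integrableM_le1 => //.
- exact: integrable_tensor.
- exact: measurable_cosine.
- by move=> x; exact: cos_max.
Qed.

Lemma osc2_swap b c xi th : mu.-integrable setT (EFin \o b) ->
  mu.-integrable setT (EFin \o c) ->
  osc2 b c xi th = osc2 c b (xi.2, xi.1) th.
Proof.
move=> ib ic; rewrite /osc2 /Rintegral; congr fine.
have I1 := integrable_osc2 xi th ib ic.
have I2 := integrable_osc2 (xi.2, xi.1) th ic ib.
rewrite -(integral12_prod_meas1 I1) -(integral21_prod_meas1 I2).
apply: eq_integral => x _; apply: eq_integral => y _.
by rewrite /tensor /dot2 /= [b x * c y]mulrC [x * xi.1 + _]addrC.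
Qed.

(** By Fubini the integral over the second variable is an [osc] whose phase depends
    on the first variable, and the bound of [osc_decay] is uniform in the phase. *)
Lemma osc2_decay_snd l h b c n : l <= h -> mu.-integrable setT (EFin \o b) ->
  smooth c -> supported l h c ->
  exists2 C, 0 <= C & forall xi th, `|xi.2| ^+ n * `|osc2 b c xi th| <= C.
Proof.
move=> lh ib sc c0; have ic := integrable_smooth_supported sc c0.
have [C C0 HC] := osc_decay n lh sc c0.
have ibn : mu.-integrable setT (EFin \o (fun x => `|b x|)).
  by have := integrable_abse ib; apply: eq_integrable.
pose B := Rintegral mu setT (fun x => `|b x|).
have B0 : 0 <= B by exact: Rintegral_ge0.
exists (C * B); first exact: mulr_ge0.
move=> xi th; have [->|xin] := eqVneq (`|xi.2| ^+ n) 0.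
  by rewrite mul0r mulr_ge0.
have xip : 0 < `|xi.2| ^+ n by rewrite lt_def xin exprn_ge0.
rewrite -ler_pdivlMl// mulrA -lee_fin.
have I := integrable_osc2 xi th ib ic.
rewrite EFin_normr_Rintegral// -(integral12_prod_meas1 I).
have IF := integrable_fubini_F I.
apply: le_trans (le_abse_integral _ _ (measurable_int _ IF)) _ => //.
have -> : ((`|xi.2| ^+ n)^-1 * C * B)%:E =
    (\int[mu]_x (((`|xi.2| ^+ n)^-1 * C) * `|b x|)%:E)%E.
  under eq_integral do rewrite EFinM.
  rewrite integralZl// EFinM /B /Rintegral fineK//; exact: integrable_fin_num ibn.
have K0 : 0 <= (`|xi.2| ^+ n)^-1 * C by rewrite mulr_ge0// invr_ge0 ltW.
apply: ge0_le_integral => //.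
- by apply: measurableT_comp => //; exact: measurable_int IF.
- apply/measurable_EFinP; apply: measurable_funM => //.
  by apply/measurable_EFinP; exact: measurable_int ibn.
move=> x _; rewrite /fubini_F.
have iosc : mu.-integrable setT
    (EFin \o (fun y => c y * cos (y * xi.2 + (x * xi.1 + th)))).
  apply: (integrable_supported c0); first exact: smooth_continuous.
  exact: continuous_cosine.
have -> : (\int[mu]_y (tensor b c (x, y) * cos (dot2 (x, y) xi + th))%:E)%E =
    (b x * osc c xi.2 (x * xi.1 + th))%:E.
  rewrite EFinM /osc /Rintegral fineK; last exact: integrable_fin_num iosc.
  rewrite -integralZl//; apply: eq_integral => y _.
  by rewrite /= -EFinM /tensor /dot2 /= -mulrA addrA [x * _ + _]addrC.
rewrite lee_fin normrM mulrC ler_wpM2r// ler_pdivlMl//.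
Qed.

(** Decay in each of the two frequencies suffices, since [1 + dot2 xi xi] is at most
    three times one of 1, [xi.1 ^+ 2] and [xi.2 ^+ 2]. *)
Lemma osc2_decay l h b c n : l <= h -> smooth b -> supported l h b ->
  smooth c -> supported l h c ->
  exists2 C, 0 <= C & forall xi th,
    (1 + dot2 xi xi) ^+ n * `|osc2 b c xi th| <= C.
Proof.
move=> lh sb b0 sc c0.
have ib := integrable_smooth_supported sb b0.
have ic := integrable_smooth_supported sc c0.
have [C0 C0p H0] := osc2_decay_snd 0 lh ib sc c0.
have [C2 C2p H2] := osc2_decay_snd n.*2 lh ib sc c0.
have [C1 C1p H1] := osc2_decay_snd n.*2 lh ic sb b0.
exists (3 ^+ n * (C0 + C1 + C2)).
  by rewrite mulr_ge0 ?exprn_ge0// !addr_ge0.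
move=> xi th.
have key (X : R) : 0 <= X -> 1 + dot2 xi xi <= 3 * X ->
    X ^+ n * `|osc2 b c xi th| <= C0 + C1 + C2 ->
    (1 + dot2 xi xi) ^+ n * `|osc2 b c xi th| <= 3 ^+ n * (C0 + C1 + C2).
  move=> X0 le1 le2.
  have d0 := ltW (weight_base_gt0 xi).
  apply: (@le_trans _ _ ((3 * X) ^+ n * `|osc2 b c xi th|)).
    by rewrite ler_wpM2r// lerXn2r ?nnegrE// mulr_ge0.
  by rewrite exprMn -mulrA ler_wpM2l// exprn_ge0.
have := H0 xi th; rewrite expr0 mul1r => h0.
have sq (t : R) : `|t| ^+ n.*2 = (t * t) ^+ n.
  by rewrite -mul2n exprM real_normK ?num_real// expr2.
have := H2 xi th; rewrite sq => h2.
have := H1 (xi.2, xi.1) th; rewrite -osc2_swap// sq /= => h1.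
have [x1|x1] := leP (xi.1 * xi.1) 1; have [y1|y1] := leP (xi.2 * xi.2) 1.
- by apply: (key 1) => //; rewrite ?expr1n ?mul1r /dot2; lra.
- by apply: (key (xi.2 * xi.2)); rewrite ?/dot2; lra.
- by apply: (key (xi.1 * xi.1)); rewrite ?/dot2; lra.
have [xy|xy] := leP (xi.1 * xi.1) (xi.2 * xi.2).
  by apply: (key (xi.2 * xi.2)); rewrite ?/dot2; lra.
by apply: (key (xi.1 * xi.1)); rewrite ?/dot2; lra.
Qed.

End decay.

(** * Functions of zero Sobolev norm *)

Section plane.
Context {R : realType}.
Implicit Types (b c : R -> R) (f g : R * R -> R[i]).
Notation mu := (@lebesgue_measure R).
Notation P2 := (measurableTypeR R * measurableTypeR R)%type.

Lemma integrable_oneDsqrV :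
  mu.-integrable setT (EFin \o (fun x : R => (oneDsqr x)^-1)).
Proof.
have cV : continuous (fun x : R => (oneDsqr x)^-1) by exact: continuous_oneDsqrV.
have V0 (x : R) : 0 <= (oneDsqr x)^-1 by rewrite invr_ge0 (le_trans ler01)// oneDsqr_ge1.
apply/integrableP; split.
  by apply/measurable_EFinP; exact: continuous_measurable_fun.
under eq_integral do rewrite /= ger0_norm//.
rewrite ge0_symfun_integralT//; last by move=> x; rewrite /= /oneDsqr sqrrN.
have -> : [set x : R | (0 <= x)%R] = `[0, +oo[%classic.
  by apply/seteqP; split => x /=; rewrite in_itv /= andbT.
by rewrite integral0y_oneDsqr -EFinM ltry.
Qed.

Lemma inv_fourier_tensorE b c xi :
  complex.Re (inv_fourier (tensor b c) xi) = (2 * pi)^-1 * osc2 b c xi 0 /\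
  complex.Im (inv_fourier (tensor b c) xi) = (2 * pi)^-1 * osc2 b c xi (- (pi / 2)).
Proof.
rewrite /inv_fourier /cintegral /=; split; rewrite ?mul0r ?subr0 ?addr0.
  congr (_ * _); apply: eq_Rintegral => x _.
  by rewrite /reF /cis /= mul0r subr0 addr0.
congr (_ * _); apply: eq_Rintegral => x _.
by rewrite /imF /cis /= mul0r addr0 cosBpihalf.
Qed.

(** With [P] the Sobolev weight, [K / q] a bound on the transform of a test function
    and [V] an integrable function, this splits a product under the integral into a
    part controlled by the Sobolev norm and a part of finite integral. It is
    the duality between Sobolev spaces of opposite orders in additive form. *)
Lemma weighted_AMGM (u K q P V e : R) : 0 < q -> 0 < P -> 0 < e ->
  1 <= V * (P * q ^+ 2) ->
  `|u| * (K / q) <= 2^-1 * (e^-1 * (P * u ^+ 2) + e * (K ^+ 2 * V)).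
Proof.
move=> q0 P0 e0 VPq.
have D0 : 0 < e * P * q ^+ 2 by rewrite !mulr_gt0 ?exprn_gt0.
apply: (@le_trans _ _ (2^-1 * (e^-1 * (P * u ^+ 2) + e * (K ^+ 2 / (P * q ^+ 2))))); last first.
  rewrite ler_wpM2l ?invr_ge0// lerD2l ler_wpM2l ?(ltW e0)// ler_wpM2l ?sqr_ge0//.
  by rewrite -[leLHS]mul1r ler_pdivrMr// mulr_gt0 ?exprn_gt0.
rewrite -subr_ge0 -(real_normK (num_real u)).
have -> : 2^-1 * (e^-1 * (P * `|u| ^+ 2) + e * (K ^+ 2 / (P * q ^+ 2))) - `|u| * (K / q)
   = (P * `|u| * q - e * K) ^+ 2 / (2 * (e * P * q ^+ 2)).
  by field; rewrite !gt_eqF.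
by rewrite divr_ge0 ?sqr_ge0// mulr_ge0// ltW.
Qed.

(** For negative [s] the weight decays; a high power of [1 + dot2 xi xi] from the
    decay of the test function compensates. Any total exponent at least 2 works,
    as [(1 + x^2 + y^2)^2 >= (1 + x^2) (1 + y^2)]. *)
Lemma weight_exponent (s : R) : exists n : nat, forall xi : R * R,
  1 <= tensor (fun x => (oneDsqr x)^-1) (fun x => (oneDsqr x)^-1) xi *
    (weight s xi * ((1 + dot2 xi xi) ^+ n) ^+ 2).
Proof.
pose n := Num.bound `|2 - s|; exists n => -[x y].
have nge : 2 - s <= n%:R by apply: le_trans (ler_norm _) _; apply/ltW/archi_boundP.
set X := 1 + dot2 (x, y) (x, y).
have X1 : 1 <= X by rewrite /X lerDl addr_ge0// -expr2 sqr_ge0.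
have X0 : 0 < X by lra.
have x2 := sqr_ge0 x; have y2 := sqr_ge0 y.
rewrite /tensor /oneDsqr /= -invfM.
have pos : 0 < (1 + x ^+ 2) * (1 + y ^+ 2) by rewrite mulr_gt0; lra.
rewrite ler_pdivlMl// mulr1; apply: (@le_trans _ _ (X ^+ 2)).
  by rewrite /X /dot2 /= -!expr2; nra.
rewrite -exprM -!powR_mulrn ?(ltW X0)// /weight -/X -powRD; last by rewrite (gt_eqF X0) implybT.
rewrite ler_powR// natrM.
have : 0 <= n%:R :> R by [].
by lra.
Qed.

Lemma supported_norm l h b x : supported l h b -> `|l| + `|h| < `|x| -> b x = 0.
Proof.
move=> b0 xr; apply: b0; have := normr_ge0 l; have := normr_ge0 h => nh nl.
have := ler_norm h; have := ler_norm (- l); rewrite normrN => ln hn.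
have [x0|x0] := leP 0 x.
  by right; move: xr; rewrite (ger0_norm x0); lra.
by left; move: xr; rewrite (ltr0_norm x0); lra.
Qed.

Lemma lt_poweR_half (S : \bar R) (e : R) : (0 <= S)%E -> 0 < e ->
  (S `^ 2^-1 < e%:E)%E -> (S <= (e ^+ 2)%:E)%E.
Proof.
move=> S0 e0; apply: contraTT; rewrite -ltNge -leNgt => eS.
have -> : e%:E = ((e ^+ 2)%:E `^ 2^-1)%E.
  by rewrite poweR_EFin powR12_sqrt ?sqr_ge0// sqrtr_sqr gtr0_norm.
by apply: gt0_ler_poweR; rewrite ?in_itv /= ?leey ?andbT ?lee_fin ?sqr_ge0// ltW.
Qed.

Lemma le0_of_small_bound (a B : R) : (forall e, 0 < e -> a <= e * B) -> a <= 0.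
Proof.
move=> H; rewrite leNgt; apply/negP => a0.
have B0 : 0 < B by have := H 1 ltr01; lra.
have := H (a / (2 * B)); rewrite divr_gt0 ?mulr_gt0// => /(_ isT).
have -> : a / (2 * B) * B = a / 2 by field; rewrite gt_eqF.
lra.
Qed.

(** The factor [e] measures how close the transform [g] comes to norm zero, and
    everything else on the right is independent of [g]. *)
Lemma fourier_test_bound s n f g b c (K e : R) :
  is_fourier f g -> test_function (tensor b c) -> 0 < e ->
  (forall xi, `|complex.Re (inv_fourier (tensor b c) xi)| <= K / (1 + dot2 xi xi) ^+ n) ->
  (forall xi, `|complex.Im (inv_fourier (tensor b c) xi)| <= K / (1 + dot2 xi xi) ^+ n) ->
  (forall xi : R * R,
    1 <= tensor (fun x => (oneDsqr x)^-1) (fun x => (oneDsqr x)^-1) xi *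
    (weight s xi * ((1 + dot2 xi xi) ^+ n) ^+ 2)) ->
  ((\int[leb2]_xi (weight s xi * sqnormc (g xi))%:E) `^ 2^-1 < e%:E)%E ->
  `|Rintegral leb2 setT (fun x => reF f x * tensor b c x)| <=
  e * (1 + K ^+ 2 * Rintegral leb2 setT
     (tensor (fun x => (oneDsqr x)^-1) (fun x => (oneDsqr x)^-1))).
Proof.
set V := tensor (fun x => (oneDsqr x)^-1) _; set S := (\int[leb2]_xi _)%E.
move=> [mr mi fg] tst e0 Kr Ki Hn Se.
have [_ [ih _] [E _]] := fg _ tst.
have -> : Rintegral leb2 setT (fun x => reF f x * tensor b c x) =
    Rintegral leb2 setT (reF (fun xi => g xi * inv_fourier (tensor b c) xi)).
  rewrite -E; apply: eq_Rintegral => x _.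
  by rewrite /reF; case: (f x) => u v /=; rewrite mulr0 subr0.
have F0 xi : (0 <= (weight s xi * sqnormc (g xi))%:E)%E.
  by rewrite lee_fin mulr_ge0 ?weight_ge0 ?sqnormc_ge0.
have S0 : (0 <= S)%E by apply: integral_ge0 => xi _; exact: F0.
have SE := lt_poweR_half S0 e0 Se.
have iV : leb2.-integrable setT (EFin \o V).
  by apply: integrable_tensor; exact: integrable_oneDsqrV.
have mF : measurable_fun setT
    (fun xi : P2 => (weight s xi * sqnormc (g xi))%:E).
  apply/measurable_EFinP; apply: measurable_funM; first exact: measurable_weight.
  exact: measurable_sqnormc.
have mV : measurable_fun setT (EFin \o V : P2 -> _) by exact: measurable_int iV.
have V0 xi : 0 <= V xi.
  by rewrite mulr_ge0 ?invr_ge0// (le_trans ler01)// oneDsqr_ge1.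
rewrite -lee_fin EFin_normr_Rintegral//.
apply: le_trans (le_abse_integral _ _ (measurable_int _ ih)) _ => //.
have -> : (e * (1 + K ^+ 2 * Rintegral leb2 setT V))%:E =
   (e^-1%:E * (e ^+ 2)%:E + (e * K ^+ 2)%:E * \int[leb2]_xi (V xi)%:E)%E.
  have -> : (\int[leb2]_xi (V xi)%:E)%E = (Rintegral leb2 setT V)%:E.
    by rewrite /Rintegral fineK//; exact: integrable_fin_num iV.
  by rewrite -!EFinM -EFinD; congr EFin; field; rewrite gt_eqF.
apply: (@le_trans _ _ (e^-1%:E * S + (e * K ^+ 2)%:E * \int[leb2]_xi (V xi)%:E)%E);
  last by rewrite leeD2r// lee_wpmul2l// lee_fin invr_ge0 ltW.
have e1 : 0 <= e^-1 by rewrite invr_ge0 ltW.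
have eK : 0 <= e * K ^+ 2 by rewrite mulr_ge0 ?sqr_ge0// ltW.
have -> : (e^-1%:E * S = \int[leb2]_xi (e^-1%:E * (weight s xi * sqnormc (g xi))%:E))%E.
  by rewrite ge0_integralZl_EFin// => xi _; exact: F0.
have -> : ((e * K ^+ 2)%:E * \int[leb2]_xi (V xi)%:E =
           \int[leb2]_xi ((e * K ^+ 2)%:E * (V xi)%:E))%E.
  by rewrite ge0_integralZl_EFin// => xi _; rewrite lee_fin.
rewrite -ge0_integralD//.
all: try exact: measurable_funeM.
all: try by move=> xi _; rewrite mule_ge0// lee_fin.
apply: ge0_le_integral => //.
- by apply: measurableT_comp => //; exact: measurable_int ih.
- by apply: emeasurable_funD; exact: measurable_funeM.
move=> xi _; rewrite -!EFinM -EFinD lee_fin.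
have q0 : 0 < (1 + dot2 xi xi) ^+ n by rewrite exprn_gt0// weight_base_gt0.
have P0 := weight_gt0 s xi.
have := weighted_AMGM (reF g xi) K q0 P0 e0 (Hn xi).
have := weighted_AMGM (imF g xi) K q0 P0 e0 (Hn xi).
have := ler_wpM2l (normr_ge0 (reF g xi)) (Kr xi).
have := ler_wpM2l (normr_ge0 (imF g xi)) (Ki xi).
have : 0 <= e^-1 * (weight s xi * sqnormc (g xi)).
  by rewrite !mulr_ge0 ?weight_ge0 ?sqnormc_ge0.
have := V0 xi; rewrite -!normrM /sqnormc /reF /imF.
case: (g xi) (inv_fourier _ xi) => gr gi [hr hi] /=.
move=> v0 H0 H1 H2 H3 H4.
apply: le_trans (ler_normB _ _) _.
set P := weight s xi in H0 H3 H4 *; set v := V xi in H3 H4 *.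
lra.
Qed.

(** A norm equal to zero is an infimum: it provides, for each [e], a transform of norm
    less than [e], possibly a different one each time. The bound of
    [fourier_test_bound] depends on [e] alone, so it applies to each of them. *)
Lemma Rintegral_test_eq0 s f l h b c : sobolev_norm_plane s f = 0%E ->
  l <= h -> smooth b -> supported l h b -> smooth c -> supported l h c ->
  leb2.-integrable setT (EFin \o (fun x => reF f x * tensor b c x)) /\
  Rintegral leb2 setT (fun x => reF f x * tensor b c x) = 0.
Proof.
move=> N0 lh sb b0 sc c0.
have tst : test_function (tensor b c).
  by apply: (@test_function_tensor _ _ _ (`|l| + `|h|)) => // x; exact: supported_norm.
have small e : 0 < e -> exists2 g, is_fourier f g &
    ((\int[leb2]_xi (weight s xi * sqnormc (g xi))%:E) `^ 2^-1 < e%:E)%E.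
  move=> e0; have : (sobolev_norm_plane s f < e%:E)%E by rewrite N0 lte_fin.
  by move=> /ereal_inf_lt[_ [g fg <-] ge]; exists g.
split.
  have [g [_ _ fg] _] := small 1 ltr01.
  have [[ifr _] _ _] := fg _ tst; apply: eq_integrable ifr => // x _.
  by rewrite /reF /=; case: (f x) => u v /=; rewrite mulr0 subr0.
have [n Hn] := weight_exponent s.
have [C C0 HC] := osc2_decay n lh sb b0 sc c0.
have pi0 : 0 < (2 * pi)^-1 :> R by rewrite invr_gt0 mulr_gt0// pi_gt0.
have K th xi : `|(2 * pi)^-1 * osc2 b c xi th| <=
    ((2 * pi)^-1 * C) / (1 + dot2 xi xi) ^+ n.
  have w0 := weight_base_gt0 xi.
  rewrite normrM gtr0_norm// -mulrA ler_wpM2l ?(ltW pi0)// ler_pdivlMr ?exprn_gt0//.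
  by rewrite mulrC.
apply/eqP; rewrite -normr_le0; apply: le0_of_small_bound => e e0.
have [g fg ge] := small e e0.
by apply: (fourier_test_bound fg tst e0 _ _ Hn ge) => xi;
  have [Er Ei] := inv_fourier_tensorE b c xi; rewrite ?Er ?Ei.
Qed.

Lemma supported_bump1 l h (a b : R) : l <= a -> b <= h -> supported l h (bump1 a b).
Proof. by move=> la bh x [xl|hx]; apply: bump1_eq0; [left|right]; lra. Qed.

(** A bump supported where [reF f] is positive would have positive integral against
    it. *)
Lemma reF_le0_plane s f p : sobolev_norm_plane s f = 0%E ->
  continuous (reF f) -> reF f p <= 0.
Proof.
move=> N0 cf; rewrite leNgt; apply/negP => fp.
have [e e0 He] := continuous_box_gt (cf p) fp.
pose b := bump1 (p.1 - e) (p.1 + e); pose c := bump1 (p.2 - e) (p.2 + e).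
pose r := `|p.1| + `|p.2| + e.
have n1 := normr_ge0 p.1; have n2 := normr_ge0 p.2.
have /andP[l1 h1] : - `|p.1| <= p.1 <= `|p.1| by rewrite -ler_norml.
have /andP[l2 h2] : - `|p.2| <= p.2 <= `|p.2| by rewrite -ler_norml.
have sb : supported (- r) r b by apply: supported_bump1; rewrite /r; lra.
have sc : supported (- r) r c by apply: supported_bump1; rewrite /r; lra.
have rr : - r <= r by rewrite /r; lra.
have [Iu Iu0] := Rintegral_test_eq0 N0 rr (smooth_bump1 _ _) sb (smooth_bump1 _ _) sc.
pose u x := reF f x * tensor b c x.
have u0 x : 0 <= u x.
  have [bx|nbx] := pselect (box p e x).
    by rewrite mulr_ge0 ?(ltW (He x bx))// mulr_ge0 ?bump1_ge0.
  suff -> : u x = 0 by [].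
  have out (y z : R) : ~~ (`|y - z| <= e) -> bump1 (z - e) (z + e) y = 0.
    move=> yz; apply: bump1_eq0; move: yz; rewrite ler_distl negb_and -!ltNge.
    by move=> /orP[]; [left|right].
  rewrite /u /tensor; have [x1|/out] := boolP (`|x.1 - p.1| <= e).
    have [x2|/out] := boolP (`|x.2 - p.2| <= e); first by case: nbx.
    by rewrite /c => ->; rewrite !mulr0.
  by rewrite /b => ->; rewrite mul0r mulr0.
have up : 0 < u p.
  have b0 (a : R) : 0 < bump1 (a - e) (a + e) a by apply: bump1_gt0; lra.
  by apply: mulr_gt0 => //; apply: mulr_gt0; exact: b0.
have cu : {for p, continuous u}.
  apply: cvgM; first exact: cf.
  by apply: differentiable_continuous; apply: differentiable_tensor; exact: smooth_bump1.
have u2 : u p / 2 < u p by lra.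
(* The bump tends to 0 at the edge of its support, so a smaller box is needed. *)
have [d d0 Hd] := continuous_box_gt cu u2.
have := Rintegral_ge_box (m := u p / 2) measurableT Iu (fun x _ => u0 x) d0.
rewrite Iu0 => /(_ p (fun _ _ => I)).
have uh : 0 < u p / 2 by lra.
move=> /(_ (fun x bx => ltW (Hd x bx)) (ltW uh)).
by rewrite leNgt pmulr_rgt0// exprn_gt0// mulr_gt0.
Qed.

Lemma reF_le0_sobolev M s f p : in_sobolev M s f -> sobolev_norm M s f = 0%E ->
  continuous (reF f) -> reF f p <= 0.
Proof.
case: M => [_|]; [exact: reF_le0_plane|exact: reF_le0_torus].
Qed.

(** The sign information on the real part is applied to the multiples of [f] by the
    four units [1], [-1], [i], [-i]. *)
Lemma sobolev_norm_eq0 M s f p : in_sobolev M s f -> sobolev_norm M s f = 0%E ->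
  continuous (reF f) -> continuous (imF f) -> f p = 0.
Proof.
move=> Hf N0 cr ci.
have le0 (a : R[i]) : reF (fun x => a * f x) p <= 0.
  apply: (@reF_le0_sobolev M s).
  - by have [] := in_sobolevZ_le a Hf.
  - by rewrite sobolev_normZ// N0 mule0.
  rewrite reF_mulE => x; apply: cvgB; apply: cvgM.
  - exact: cvg_cst.
  - exact: cr.
  - exact: cvg_cst.
  - exact: ci.
have := le0 1; have := le0 (- 1); have := le0 (0 +i* 1); have := le0 (0 +i* -1).
rewrite !reF_mulE /reF /imF /=; case: (f p) => x y /= h1 h2 h3 h4.
by apply/eqP; rewrite eq_complex /= !eq_le; lra.
Qed.

End plane.

(** * Conservation of the quotient *)

Unset Implicit Arguments.
Set Strict Implicit.

Theorem theorem2p2 (R : realType) (M : domain) (s : R) (J : set R)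
    (Psi Omega : R -> R * R -> R) (lambda : R[i]) (phi : R -> R * R -> R[i])
    (J_open : open J) (J_interval : is_interval J)
    (Omega_euler : euler_solution M J Psi Omega)
    (lambda_imaginary : complex.Re lambda = 0)
    (phi_sobolev : forall t, J t -> in_sobolev M s (phi t))
    (phi_neq0 : forall t, J t -> exists p, phi t p <> 0)
    (phi_lax : lax_solution M J Psi Omega lambda phi) :
  forall t1 t2, J t1 -> J t2 ->
    lax_quotient M s Omega phi t1 = lax_quotient M s Omega phi t2.
Proof.
suff H t : J t -> lax_quotient M s Omega phi t = absc lambda.
  by move=> t1 t2 /H -> /H ->.
move=> Jt; have [_ dphi _ eigen _] := phi_lax t Jt.
have Hs := phi_sobolev t Jt; have [_ fin] := Hs.
rewrite /lax_quotient (_ : cbracket _ _ = fun p => lambda * phi t p); last exact/funext.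
have N0 : fine (sobolev_norm M s (phi t)) != 0.
  apply/eqP => N0; have [p] := phi_neq0 t Jt; apply.
  apply: (@sobolev_norm_eq0 _ M s) => //.
  - by rewrite -[LHS]fineK ?N0// ge0_fin_numE ?sobolev_norm_ge0.
  - by move=> x; apply: differentiable_continuous; have [] := dphi x.
  - by move=> x; apply: differentiable_continuous; have [] := dphi x.
by rewrite sobolev_normZ// fineM ?mulfK// ge0_fin_numE ?sobolev_norm_ge0.
Qed.
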